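(* Let $\mathcal X,\mathcal Y,f,L,L_0,\widehat L,V,q$ be as in the context, with $\widehat L>L$, and suppose the sampling (lower-mass) condition and the PL condition stated in the context hold. Then, for any $N\ge1$, with $V_N(x)=\max_{j\in[N]}q(x,y_j)$ and $\beta_N=\max_{y\in\mathcal Y}\min_{j\in[N]}\|y-y_j\|$, $$d\big(\partial V_N(x),\partial V(x)\big)\le L_\kappa(x)\,\beta_N,\qquad\forall x\in\mathcal X,$$ where $$L_\kappa(x):=\Big(D_{\mathcal Y}L_0+\Big(3+\frac{L}{\widehat L}\Big)L\Big)\sqrt{\frac{\widehat L}{\kappa_q(x)}},\qquad \kappa_q(x):=\frac{\kappa_p(x)(\widehat L-L)}{2\kappa_p(x)+8(\widehat L-L)} .$$
   Context: $\|\cdot\|$ is the Euclidean norm (operator norm for matrices), $[N]=\{1,\ldots,N\}$. $\mathcal X\subseteq\mathbb R^n$ and $\mathcal Y\subseteq\mathbb R^m$ are nonempty, compact, convex sets. $f$ is a real-valued function, twice continuously differentiable in an open neighborhood of $\mathcal X\times\mathcal Y$, and there are constants $L,L_0>0$ such that for all $(x,y),(x',y')\in\mathcal X\times\mathcal Y$: $\|\nabla f(x,y)-\nabla f(x',y')\|\le L\|(x,y)-(x',y')\|$ and $\|\nabla^2_{xy}f(x,y)-\nabla^2_{xy}f(x',y')\|\le L_0\|(x,y)-(x',y')\|$. Moreover $L$ is chosen large enough that also $\|\nabla f(x,y)\|\le L$ on $\mathcal X\times\mathcal Y$. $\widehat L>L$ is a fixed constant. Define $$V(x)=\max_{y\in\mathcal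 Y}f(x,y),\qquad q(x,y)=f(x,y)+\max_{z\in\mathcal Y}\Big(\langle\nabla_yf(x,y),z-y\rangle-\tfrac{\widehat L}{2}\|z-y\|^2\Big).$$ Sampling (lower-mass) condition: $y_1,y_2,\ldots$ are i.i.d. samples from a probability measure $P$ supported on $\mathcal Y$, $Y_N=\{y_1,\ldots,y_N\}$, and there are constants $C_0,\gamma,\delta_0>0$ with $P(\{y\in\mathcal Y:\|y-y_0\|\le\delta\})\ge C_0\delta^\gamma$ for all $y_0\in\mathcal Y$ and $\delta\in(0,\delta_0)$. PL condition: for any $x\in\mathcal X$ there is a constant $\kappa_p(x)>0$ such that for all $y\in\mathcal Y$, $\kappa_p(x)\big(V(x)-f(x,y)\big)\le\operatorname{dist}^2\big(0,-\nabla_yf(x,y)+\mathcal N_{\mathcal Y}(y)\big)$, where $\mathcal N_{\mathcal Y}(y)=\{\xi:\langle\xi,y'-y\rangle\le0\ \forall y'\in\mathcal Y\}$ is the normal cone. $D_{\mathcal Y}=\sup\{\|y-y'\|:y,y'\in\mathcal Y\}$ is the diameter of $\mathcal Y$. $\partial$ denotes the Clarke subdifferential: $\partial h(\bar x)=\{z:\langle z,d\rangle\le\limsup_{x\to\bar x,t\downarrow0}(h(x+td)-h(x))/t\ \forall d\}$; the functions $V,V_N$ are understood to be defined by the same formulas for $x$ in an open neighborhood of $\mathcal X$. $d(A,B)=\sup_{a\in A}\inf_{b\in B}\|a-b\|$. *)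

(* Defs.v *)
From HB Require Import structures.
From mathcomp Require Import all_boot all_order all_algebra.
From mathcomp Require Import all_classical all_reals all_analysis.
Import Order.TTheory GRing.Theory Num.Theory.
Import numFieldNormedType.Exports.

Set Implicit Arguments.
Unset Strict Implicit.
Unset Printing Implicit Defensive.

Local Open Scope classical_set_scope.
Local Open Scope ring_scope.

Section Euclidean.
Context {R : realType}.

Definition dot {n} (u v : 'rV[R]_n) : R := \sum_(i < n) u 0 i * v 0 i.

(* The library norm on matrices is the sup norm (same topology), so the
   Euclidean norm is defined separately. *)
Definition enorm {n} (u : 'rV[R]_n) : R := Num.sqrt (dot u u).

(* [v *m A^T] is the row vector of entries of A v. *)
Definition opnorm {k l} (A : 'M[R]_(k, l)) : R :=
  sup [set enorm (v *m A^T) | v in [set v : 'rV[R]_l | enorm v <= 1]].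

Definition edist {n} (u : 'rV[R]_n) (S : set 'rV[R]_n) : R :=
  inf [set enorm (u - s) | s in S].

Definition diam {n} (S : set 'rV[R]_n) : R :=
  sup [set enorm (p.1 - p.2) | p in S `*` S].

(* d(A, B); extended-real valued, since A and B are arbitrary sets. *)
Definition excess {n} (A B : set 'rV[R]_n) : \bar R :=
  ereal_sup [set ereal_inf [set (enorm (a - b))%:E | b in B] | a in A].

Definition normal_cone {n} (S : set 'rV[R]_n) (y : 'rV[R]_n) : set 'rV[R]_n :=
  [set xi | forall y', S y' -> dot xi (y' - y) <= 0].

(* The limsup is taken in the extended reals, over base points near [xbar]
   ([xbar] included) and t > 0 near 0. *)
Definition clarke {n} (h : 'rV[R]_n -> R) (xbar : 'rV[R]_n) : set 'rV[R]_n :=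
  [set z | forall d : 'rV[R]_n,
    ((dot z d)%:E <=
     limf_esup (fun p : 'rV[R]_n * R => ((h (p.1 + p.2 *: d) - h p.1) / p.2)%R%:E)
               (filter_prod (nbhs xbar) (0 : R)^'+))%E].

End Euclidean.

Section Calculus.
Context {R : realType} {n m : nat}.
Implicit Types (f : 'rV[R]_n * 'rV[R]_m -> R) (p : 'rV[R]_n * 'rV[R]_m).

Definition pnorm p : R := enorm (row_mx p.1 p.2).

Definition gradx f p : 'rV[R]_n :=
  \row_i 'D_((delta_mx 0 i, 0) : 'rV[R]_n * 'rV[R]_m) f p.

Definition grady f p : 'rV[R]_m :=
  \row_j 'D_((0, delta_mx 0 j) : 'rV[R]_n * 'rV[R]_m) f p.

Definition grad f p : 'rV[R]_(n + m) := row_mx (gradx f p) (grady f p).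

Definition hessxy f p : 'M[R]_(n, m) :=
  \matrix_(i, j) 'D_((0, delta_mx 0 j) : 'rV[R]_n * 'rV[R]_m)
                   (fun p' => gradx f p' 0 i) p.

(* In finite dimension, continuity of the second derivative is continuity of
   all the second directional derivatives. *)
Definition C2_on (U : set ('rV[R]_n * 'rV[R]_m)) f : Prop :=
  forall p, U p ->
    [/\ differentiable f p,
        forall v, differentiable ('D_v f) p
      & forall v w, {for p, continuous ('D_w ('D_v f))}].

End Calculus.

Section Minimax.
Context {R : realType} {n m : nat}.
Variables (f : 'rV[R]_n * 'rV[R]_m -> R) (Y : set 'rV[R]_m) (Lhat : R).

(* The maxima and minima below are written [sup] and [inf]; they are attained
   by compactness of Y, resp. finiteness of the sample. *)
Definition V (x : 'rV[R]_n) : R := sup [set f (x, y) | y in Y].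

Definition q (x : 'rV[R]_n) (y : 'rV[R]_m) : R :=
  f (x, y) + sup [set dot (grady f (x, y)) (z - y)
                      - Lhat / 2 * enorm (z - y) ^+ 2 | z in Y].

Definition VN (N : nat) (s : 'I_N -> 'rV[R]_m) (x : 'rV[R]_n) : R :=
  sup [set q x (s j) | j in setT].

Definition beta (N : nat) (s : 'I_N -> 'rV[R]_m) : R :=
  sup [set inf [set enorm (y - s j) | j in setT] | y in Y].

Definition PL (X : set 'rV[R]_n) (kappap : 'rV[R]_n -> R) : Prop :=
  forall x, X x -> 0 < kappap x /\
    forall y, Y y ->
      kappap x * (V x - f (x, y)) <=
      edist 0 [set - grady f (x, y) + xi | xi in normal_cone Y y] ^+ 2.

Definition kappaq (L : R) (kappap : 'rV[R]_n -> R) (x : 'rV[R]_n) : R :=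
  kappap x * (Lhat - L) / (2 * kappap x + 8 * (Lhat - L)).

Definition Lkappa (L L0 : R) (kappap : 'rV[R]_n -> R) (x : 'rV[R]_n) : R :=
  (diam Y * L0 + (3 + L / Lhat) * L) * Num.sqrt (Lhat / kappaq L kappap x).

End Minimax.

Definition borel_rV (R : realType) (m : nat) : measurableType _ :=
  g_sigma_algebraType (@open 'rV[R]_m).

Section Sampling.
Context {R : realType} {m : nat} {d : measure_display} {T : measurableType d}.
Variable (Pr : probability T R).

Definition mutually_independent (y : nat -> {RV Pr >-> borel_rV R m}) : Prop :=
  forall (J : seq nat) (B : nat -> set (borel_rV R m)),
    uniq J -> (forall j, measurable (B j)) ->
    Pr (\bigcap_(j in [set` J]) (y j @^-1` B j)) =
    (\prod_(j <- J) Pr (y j @^-1` B j))%E.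

Definition iid_samples (P : probability (borel_rV R m) R)
    (y : nat -> {RV Pr >-> borel_rV R m}) : Prop :=
  mutually_independent y /\
  forall j (B : set (borel_rV R m)), measurable B -> distribution Pr (y j) B = P B.

Definition lower_mass (P : probability (borel_rV R m) R) (Y : set 'rV[R]_m)
    (C0 gamma delta0 : R) : Prop :=
  forall (y0 : 'rV[R]_m) (delta : R), Y y0 -> 0 < delta < delta0 ->
    ((C0 * delta `^ gamma)%:E <=
     P [set y : 'rV[R]_m | Y y /\ (enorm (y - y0) <= delta)%R])%E.

End Sampling.

(* Main.v *)
Require Import Defs.
From HB Require Import structures.
From mathcomp Require Import all_boot all_order all_algebra.
From mathcomp Require Import all_classical all_reals all_analysis.
From mathcomp Require Import ring lra.
Import Order.TTheory GRing.Theory Num.Theory.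
Import numFieldNormedType.Exports.

(* Every active sample y_j satisfies V(x) - q(x, y_j) <= Lhat beta^2: expand q at
   a sample within beta of a maximizer of f(x, _).  The PL condition gives quadratic
   growth of V(x) - f(x, _) by minimizing sqrt(V(x) - f(x, _)) plus a smoothed
   distance term over Y; with the strong concavity of the model defining q this
   puts y_j within sqrt(Lhat / kappa_q) beta of a maximizer ybar.  Finally,
   D_x q(x, y_j) d = D_x f(x, y_j) d + D_{z - y_j} D_d f(x, y_j), where z maximizes
   the model, and by symmetry of second derivatives the last term is the variation
   of the L-Lipschitz map grad_x f along [y_j, z], with
   |z - y_j| <= (2 + L / Lhat) |y_j - ybar|.  Hence D_x q(x, y_j) d exceeds
   <grad_x f(x, ybar), d> by at most (3 + L / Lhat) L |y_j - ybar| |d|; with d = g - b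
   for g in the subdifferential of V_N and b its projection on that of V, which
   contains grad_x f(x, ybar), this bounds |g - b|.  The term D_Y L_0 of the
   constant is slack. *)

Local Open Scope classical_set_scope.
Local Open Scope ring_scope.

Set Implicit Arguments.
Unset Strict Implicit.

(** * Euclidean geometry *)

Section InnerProduct.
Context {R : realType} {n : nat}.
Implicit Types (u v w : 'rV[R]_n) (a : R).

Lemma dotC u v : dot u v = dot v u.
Proof. by apply: eq_bigr => i _; rewrite mulrC. Qed.

Lemma dotDl u v w : dot (u + v) w = dot u w + dot v w.
Proof. by rewrite -big_split; apply: eq_bigr => i _; rewrite mxE mulrDl. Qed.

Lemma dotZl a u v : dot (a *: u) v = a * dot u v.
Proof. by rewrite mulr_sumr; apply: eq_bigr => i _; rewrite mxE mulrA. Qed.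

Lemma dotNl u v : dot (- u) v = - dot u v.
Proof. by rewrite -scaleN1r dotZl mulN1r. Qed.

Lemma dotDr u v w : dot u (v + w) = dot u v + dot u w.
Proof. by rewrite dotC dotDl !(dotC u). Qed.

Lemma dotZr a u v : dot u (a *: v) = a * dot u v.
Proof. by rewrite dotC dotZl dotC. Qed.

Lemma dotNr u v : dot u (- v) = - dot u v.
Proof. by rewrite dotC dotNl dotC. Qed.

Definition dotE := (dotDl, dotDr, dotNl, dotNr, dotZl, dotZr).

Lemma dot_ge0 u : 0 <= dot u u.
Proof. by apply: sumr_ge0 => i _; rewrite -expr2 sqr_ge0. Qed.

Lemma sqr_enorm u : enorm u ^+ 2 = dot u u.
Proof. by rewrite sqr_sqrtr // dot_ge0. Qed.

Lemma enorm_ge0 u : 0 <= enorm u.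
Proof. exact: sqrtr_ge0. Qed.

Lemma enormN u : enorm (- u) = enorm u.
Proof. by rewrite /enorm dotNl dotNr opprK. Qed.

Lemma enorm_distC u v : enorm (u - v) = enorm (v - u).
Proof. by rewrite -enormN opprB. Qed.

Lemma enormZ a u : enorm (a *: u) = `|a| * enorm u.
Proof. by rewrite /enorm dotZl dotZr mulrA -expr2 sqrtrM ?sqr_ge0// sqrtr_sqr. Qed.

Lemma enorm0 : enorm (0 : 'rV[R]_n) = 0.
Proof. by rewrite -(scale0r 0) enormZ normr0 mul0r. Qed.

Lemma coord_le_enorm u i : `|u 0 i| <= enorm u.
Proof.
rewrite -(@ler_pXn2r _ 2) ?nnegrE ?enorm_ge0// sqr_enorm real_normK ?num_real//.
rewrite /dot (bigD1 i)//= -expr2 lerDl; apply: sumr_ge0 => j _.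
by rewrite -expr2 sqr_ge0.
Qed.

Lemma enorm_eq0 u : enorm u = 0 -> u = 0.
Proof.
move=> u0; apply/rowP => i; apply/eqP; rewrite mxE -normr_le0 -u0.
exact: coord_le_enorm.
Qed.

(** Limits are expressed through the sup norm, so Euclidean estimates are turned into convergence by
    this comparison. *)
Lemma mx_norm_le_enorm u : `|u| <= enorm u.
Proof.
rewrite [leLHS]mx_normrE; apply: bigmax_le; first exact: enorm_ge0.
by move=> [i j] _ /=; rewrite (ord1 i) coord_le_enorm.
Qed.

(** The squared norm of [enorm v *: u - enorm u *: v] is nonnegative and equals
    [2 * (enorm u * enorm v)] times the difference of the two sides. *)
Lemma dot_le_enorm u v : dot u v <= enorm u * enorm v.
Proof.
have [/enorm_eq0 ->|u0] := eqVneq (enorm u) 0.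
  by rewrite -(scale0r 0) dotZl enormZ normr0 !mul0r.
have [/enorm_eq0 ->|v0] := eqVneq (enorm v) 0.
  by rewrite -(scale0r 0) dotZr enormZ normr0 !mul0r mulr0.
have {}u0 : 0 < enorm u by rewrite lt_def u0 enorm_ge0.
have {}v0 : 0 < enorm v by rewrite lt_def v0 enorm_ge0.
have := dot_ge0 (enorm v *: u - enorm u *: v).
rewrite !dotE (dotC v u) -!sqr_enorm => uv.
rewrite -subr_ge0 -(@pmulr_rge0 _ (2 * (enorm u * enorm v))) ?mulr_gt0//.
by apply: le_trans uv _; rewrite le_eqVlt; apply/orP; left; apply/eqP; ring.
Qed.

Lemma ler_enormD u v : enorm (u + v) <= enorm u + enorm v.
Proof.
rewrite -(@ler_pXn2r _ 2) ?nnegrE ?addr_ge0 ?enorm_ge0//.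
rewrite sqr_enorm !dotE (dotC v u) -!sqr_enorm.
have := dot_le_enorm u v; nra.
Qed.

Lemma ler_enormB_add w u v : enorm (u - v) <= enorm (u - w) + enorm (w - v).
Proof. by apply: le_trans (ler_enormD _ _); rewrite addrA subrK. Qed.

Lemma cvg_dot (T : Type) (F : set_system T) {FF : Filter F}
    (h k : T -> 'rV[R]_n) u v :
  h t @[t --> F] --> u -> k t @[t --> F] --> v ->
  dot (h t) (k t) @[t --> F] --> dot u v.
Proof.
move=> hu kv; apply: cvg_big => [|i _]; first exact: add_continuous.
apply: cvgM.
  by apply: (cvg_comp _ (fun A : 'rV[R]_n => A 0 i) hu); exact: coord_continuous.
by apply: (cvg_comp _ (fun A : 'rV[R]_n => A 0 i) kv); exact: coord_continuous.
Qed.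

Lemma cvg_enorm (T : Type) (F : set_system T) {FF : Filter F}
    (h : T -> 'rV[R]_n) u :
  h t @[t --> F] --> u -> enorm (h t) @[t --> F] --> enorm u.
Proof.
move=> hu; apply: (@cvg_comp _ _ _ (fun t => dot (h t) (h t)) Num.sqrt _
  (nbhs (dot u u))).
  exact: cvg_dot.
exact: sqrt_continuous.
Qed.

Lemma cvg_enorm_sub u v : enorm (u - w) @[w --> v] --> enorm (u - v).
Proof.
have cvg_subl (W : normedModType R) (a b : W) : (a - c) @[c --> b] --> a - b.
  by apply: cvgB; [exact: cvg_cst|exact: cvg_id].
exact: (cvg_enorm (cvg_subl _ u v)).
Qed.

Lemma enorm_sub_continuous u : continuous (fun v => enorm (u - v)).
Proof. by move=> v; exact: cvg_enorm_sub. Qed.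

End InnerProduct.

(** * Projection onto closed convex sets *)

Section Projection.
Context {R : realType} {n : nat}.
Implicit Types (C : set 'rV[R]_n) (u b : 'rV[R]_n).

(** The variational inequality that characterizes the nearest point of a convex set. *)
Definition is_proj C u b := C b /\ forall b', C b' -> dot (u - b) (b' - b) <= 0.

(** Boundedness is not assumed, so that Clarke subdifferentials can be projected on directly. The
    minimum is taken over the points of [C] no farther from [u] than a fixed [c], which form a
    compact set. *)
Lemma compact_argmin_enorm C u : C !=set0 -> closed C ->
  exists2 b, C b & forall b', C b' -> enorm (u - b) <= enorm (u - b').
Proof.
move=> [c Cc] Ccl.
pose K := C `&` [set b | enorm (u - b) <= enorm (u - c)].
have contd : continuous (fun b => enorm (u - b)).
  exact: enorm_sub_continuous.
have Kc : compact K.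
  apply: bounded_closed_compact; last first.
    apply: closedI => //.
    apply: (@preimage_closed _ _ (fun b => enorm (u - b))
      [set r | r <= enorm (u - c)]); last exact: closed_le.
    by move=> b _; exact: contd.
  exists (`|u| + enorm (u - c)); split; first exact: num_real.
  move=> M uM b [_ /= ub]; apply: ltW; apply: le_lt_trans uM.
  have -> : b = u - (u - b) by rewrite opprB addrC subrK.
  apply: le_trans (ler_normB _ _) _; rewrite lerD2l.
  exact: le_trans (mx_norm_le_enorm _) ub.
have [b /set_mem [Cb bc] bmin] : exists2 b, b \in K &
    forall t, t \in K -> enorm (u - b) <= enorm (u - t).
  apply: (@compact_EVT_min _ _ (fun b => enorm (u - b)) K) => //.
    by exists c; split => /=.
  exact: continuous_subspaceT.
exists b => // b' Cb'.
have [b'c|/ltW b'c] := leP (enorm (u - b')) (enorm (u - c)).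
  by apply: bmin; rewrite inE.
exact: le_trans bc b'c.
Qed.

Definition segment_closed C :=
  forall a b t, C a -> C b -> 0 <= t <= 1 -> C (a + t *: (b - a)).

Lemma convex_set_segment_closed C :
  convex_set (C : set (convex_lmodType 'rV[R]_n)) -> segment_closed C.
Proof.
move=> Ccvx a b t Ca Cb /andP[t0 t1].
have := Ccvx b a (Itv01 t0 t1); rewrite !inE => /(_ Cb Ca).
congr C; rewrite /conv/=.
by apply/rowP => i; rewrite !mxE /unstable.onem; ring.
Qed.

Lemma is_proj_ex C u : C !=set0 -> closed C -> segment_closed C ->
  exists b, is_proj C u b.
Proof.
move=> C0 Ccl Ccvx; have [b Cb bmin] := compact_argmin_enorm u C0 Ccl.
exists b; split => // b' Cb'; rewrite leNgt; apply/negP => lt0.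
have h t : 0 <= t <= 1 -> 2 * t * dot (u - b) (b' - b) <= t ^+ 2 * dot (b' - b) (b' - b).
  move=> t01.
  have : enorm (u - b) ^+ 2 <= enorm (u - (b + t *: (b' - b))) ^+ 2.
    by rewrite ler_pXn2r ?nnegrE ?enorm_ge0//; exact/bmin/Ccvx.
  rewrite !sqr_enorm opprD addrA.
  move: (u - b) (b' - b) => p r; rewrite !dotE (dotC r p); nra.
move: h lt0; move: (dot (u - b) _) (dot_ge0 (b' - b)) => p; move: (dot _ _) => r r0 h p0.
(* With [t = p / (p + r)], minimality along the segment gives [2 * p <= t * r], whereas
   [t * r <= t * (p + r) = p], a contradiction with [0 < p]. *)
have pr : 0 < p / (p + r) <= 1.
  by rewrite divr_gt0//= ?ler_pdivrMr ?mul1r; lra.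
have /h : 0 <= p / (p + r) <= 1 by case/andP: pr => /ltW -> ->.
set t := p / (p + r) in pr *; case/andP: pr => t0 t1.
have : t * (p + r) = p by rewrite /t mulfVK//; apply/eqP; lra.
nra.
Qed.

(** The sum of the two variational inequalities, each tested at the other projection, bounds the
    square of [enorm (b1 - b2)] by [dot (u1 - u2) (b1 - b2)]; Cauchy-Schwarz concludes. *)
Lemma is_proj_nonexpansive C u1 u2 b1 b2 : is_proj C u1 b1 -> is_proj C u2 b2 ->
  enorm (b1 - b2) <= enorm (u1 - u2).
Proof.
move=> [C1 h1] [C2 h2]; have := h1 _ C2; have := h2 _ C1.
have [->|b0] := eqVneq (enorm (b1 - b2)) 0; first by rewrite enorm_ge0.
have {}b0 : 0 < enorm (b1 - b2) by rewrite lt_def b0 enorm_ge0.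
move=> e2 e1; rewrite -(ler_pM2r b0) -expr2 sqr_enorm.
apply: le_trans (dot_le_enorm _ _).
by move: e1 e2; rewrite !dotE (dotC b1 b2); lra.
Qed.

(* The default value [u] is taken only when no projection exists. *)
Definition nearest C u := xget u [set b | is_proj C u b].

Lemma nearestP C u : C !=set0 -> closed C -> segment_closed C ->
  is_proj C u (nearest C u).
Proof.
by move=> C0 Ccl Ccvx; have := is_proj_ex u C0 Ccl Ccvx; exact: xgetPex.
Qed.

Lemma cvg_nearest (T : Type) (F : set_system T) {FF : Filter F} C
    (h : T -> 'rV[R]_n) u : C !=set0 -> closed C -> segment_closed C ->
  h t @[t --> F] --> u -> nearest C (h t) @[t --> F] --> nearest C u.
Proof.
move=> C0 Ccl Ccvx hu; apply/cvgrPdist_le => e e0.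
have : enorm (u - h t) @[t --> F] --> enorm (u - u).
  by apply: cvg_enorm; apply: cvgB => //; exact: cvg_cst.
rewrite subrr enorm0 => /cvgrPdist_le /(_ _ e0); apply: filterS => t.
rewrite sub0r normrN ger0_norm ?enorm_ge0// => uv.
apply: le_trans (mx_norm_le_enorm _) _; apply: le_trans uv.
by apply: (@is_proj_nonexpansive C); apply: nearestP.
Qed.

End Projection.

(** * Mean value estimates along lines *)

Section LineCalculus.
Context {R : realType} {V : normedModType R}.
Implicit Types (f : V -> R) (a v w : V).

Lemma is_derive_line f a v (s : R) : derivable f (a + s *: v) v ->
  is_derive s 1 (fun t => f (a + t *: v)) ('D_v f (a + s *: v)).
Proof.
move=> fv.
have E : (fun h : R => h^-1 *: (f (a + (h *: 1 + s) *: v) - f (a + s *: v))) =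
         (fun h : R => h^-1 *: (f (h *: v + (a + s *: v)) - f (a + s *: v))).
  apply/funext => h; congr (_ *: (f _ - _)).
  by rewrite [h *: 1]mulr1 scalerDl addrCA.
by split; [rewrite /derivable E|rewrite /derive E].
Qed.

Lemma MVT_line f a v (t : R) : 0 <= t ->
  (forall s, 0 <= s <= t -> derivable f (a + s *: v) v) ->
  exists2 s, 0 <= s <= t & f (a + t *: v) - f a = 'D_v f (a + s *: v) * t.
Proof.
move=> t0 fv.
have der s : 0 <= s <= t -> is_derive s 1 (fun t => f (a + t *: v)) ('D_v f (a + s *: v)).
  by move=> /fv; exact: is_derive_line.
have [||s st] := @MVT_segment R (fun t => f (a + t *: v))
    (fun s => 'D_v f (a + s *: v)) 0 t t0.
- by move=> s; rewrite in_itv/= => /andP[/ltW s0 /ltW s1]; apply: der; rewrite s0.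
- apply: derivable_within_continuous => s; rewrite in_itv/= => st.
  by have [] := der _ st.
- by rewrite scale0r addr0 subr0 => ->; exists s.
Qed.

(** Prepares the mean value theorem on short segments with a moving base point. Half of the radius
    absorbs the motion of the base point, the other half the displacement along [v]. *)
Lemma near_segment (T : Type) (F : set_system T) {FF : Filter F}
    (h : T -> V) (tau : T -> R) a v (P : V -> Prop) :
  h p @[p --> F] --> a -> tau p @[p --> F] --> 0 -> (\forall p \near a, P p) ->
  \forall p \near F, forall s, 0 <= s <= tau p -> P (h p + s *: v).
Proof.
move=> ha tau0 /nbhs_ballP[r /= r0 rP].
have v0 : 0 < `|v| + 1 by rewrite ltr_wpDl.
have ha2 : \forall p \near F, `|a - h p| < r / 2.
  by move/cvgrPdist_lt : ha; apply; rewrite divr_gt0.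
have tau2 : \forall p \near F, `|0 - tau p| < r / 2 / (`|v| + 1).
  by move/cvgrPdist_lt : tau0; apply; rewrite !divr_gt0.
near=> p => s /andP[s0 st]; apply: rP; rewrite -ball_normE /= opprD addrA.
apply: le_lt_trans (ler_normB _ _) _; rewrite [ltRHS]splitr ltrD//.
  by near: p.
rewrite normrZ ger0_norm//.
have : `|0 - tau p| < r / 2 / (`|v| + 1) by near: p.
rewrite sub0r normrN ltr_pdivlMr//; apply: le_lt_trans.
apply: ler_pM => //; first exact: le_trans st (ler_norm _).
by rewrite lerDl.
Unshelve. all: by end_near. Qed.

(** The base point moves together with the step, as in the Clarke derivative. The mean value theorem
    turns the quotient into a value of ['D_v f] at a nearby point, and continuity of ['D_v f] gives
    the limit. *)
Lemma cvg_diff_quotient (T : Type) (F : set_system T) {FF : Filter F}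
    (h : T -> V) (tau : T -> R) f a v :
  h p @[p --> F] --> a -> tau p @[p --> F] --> 0 ->
  (\forall p \near F, 0 < tau p) ->
  (\forall p \near a, derivable f p v) -> {for a, continuous ('D_v f)} ->
  (f (h p + tau p *: v) - f (h p)) / tau p @[p --> F] --> 'D_v f a.
Proof.
move=> ha tau0 taugt0 fv fc; apply/cvgrPdist_le => e e0.
have fe : \forall p \near a, `|'D_v f a - 'D_v f p| <= e.
  by move/cvgrPdist_le : fc; apply.
have H1 := near_segment v ha tau0 fv; have H2 := near_segment v ha tau0 fe.
near=> p.
have tp : 0 < tau p by near: p.
have fp s : 0 <= s <= tau p -> derivable f (h p + s *: v) v.
  by move: s; near: p; exact: H1.
have [s st ->] := MVT_line (ltW tp) fp.
rewrite mulfK ?gt_eqF//; move: s st; near: p.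
exact: H2.
Unshelve. all: by end_near. Qed.

(** The second difference of [f] is the increment along [v] of [g p = f (p + t *: w) - f p]. The
    mean value theorem is applied to [g] along [v], then to ['D_v f] along [w]. *)
Lemma MVT_line2 f a v w (t : R) : 0 <= t ->
  (forall s s', 0 <= s <= t -> 0 <= s' <= t ->
    derivable f (a + s *: v + s' *: w) v /\
    derivable ('D_v f) (a + s *: v + s' *: w) w) ->
  exists s s', [/\ 0 <= s <= t, 0 <= s' <= t &
    f (a + t *: v + t *: w) - f (a + t *: v) - (f (a + t *: w) - f a) =
    'D_w ('D_v f) (a + s *: v + s' *: w) * t * t].
Proof.
move=> t0 H; pose g p := f (p + t *: w) - f p.
have tt : 0 <= t <= t by apply/andP.
have oo : 0 <= (0 : R) <= t by apply/andP.
have is_g s : 0 <= s <= t ->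
    is_derive (a + s *: v) v g ('D_v f (a + s *: v + t *: w) - 'D_v f (a + s *: v)).
  move=> st; have [d1 _] := H _ _ st tt; have [d0 _] := H _ _ st oo.
  apply: is_deriveB.
    have E : (fun h : R => h^-1 *: (f (h *: v + (a + s *: v) + t *: w) -
                                     f (a + s *: v + t *: w))) =
             (fun h : R => h^-1 *: (f (h *: v + (a + s *: v + t *: w)) -
                                     f (a + s *: v + t *: w))).
      by apply/funext => h; rewrite !addrA.
    by split; [rewrite /derivable E|rewrite /derive E].
  by apply/derivableP; move: d0; rewrite scale0r addr0.
have [s st] : exists2 s, 0 <= s <= t &
    g (a + t *: v) - g a = 'D_v g (a + s *: v) * t.
  by apply: MVT_line => // s st; have [] := is_g _ st.
have [_ ->] := is_g _ st.
have [s' s't ->] : exists2 s', 0 <= s' <= t &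
    'D_v f (a + s *: v + t *: w) - 'D_v f (a + s *: v) =
    'D_w ('D_v f) (a + s *: v + s' *: w) * t.
  by apply: (@MVT_line ('D_v f) (a + s *: v) w) => // s' s't; have [] := H _ _ st s't.
by move=> E; exists s, s'.
Qed.

(** Schwarz's theorem: the second difference over a small parallelogram is symmetric in [v] and [w],
    and equals [t * t] times either mixed derivative at some point of the parallelogram. Continuity
    brings both values within [e / 2] of those at [a]. *)
Lemma derive_sym f a v w :
  (\forall p \near a, derivable f p v /\ derivable ('D_v f) p w) ->
  (\forall p \near a, derivable f p w /\ derivable ('D_w f) p v) ->
  {for a, continuous ('D_w ('D_v f))} -> {for a, continuous ('D_v ('D_w f))} ->
  'D_w ('D_v f) a = 'D_v ('D_w f) a.
Proof.
move=> fvw fwv cvw cwv; apply/eqP; rewrite -subr_eq0 -normr_le0.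
apply/ler_addgt0Pl => e e0; rewrite addr0.
pose P p := [/\ derivable f p v /\ derivable ('D_v f) p w,
  derivable f p w /\ derivable ('D_w f) p v,
  `|'D_w ('D_v f) a - 'D_w ('D_v f) p| <= e / 2 &
  `|'D_v ('D_w f) a - 'D_v ('D_w f) p| <= e / 2].
have nP : \forall p \near a, P p.
  have c1 : \forall p \near a, `|'D_w ('D_v f) a - 'D_w ('D_v f) p| <= e / 2.
    by move/cvgrPdist_le : cvw; apply; rewrite divr_gt0.
  have c2 : \forall p \near a, `|'D_v ('D_w f) a - 'D_v ('D_w f) p| <= e / 2.
    by move/cvgrPdist_le : cwv; apply; rewrite divr_gt0.
  apply: (filterS _ (filterI (filterI fvw fwv) (filterI c1 c2))).
  by move=> p [[? ?] [? ?]]; split.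
have /nbhs_ballP[r /= r0 rP] := nP.
have k0 : 0 < `|v| + `|w| + 1 by rewrite ltr_wpDl ?addr_ge0.
(* This side length keeps the whole parallelogram inside the ball of radius [r]. *)
pose t := r / 2 / (`|v| + `|w| + 1).
have t0 : 0 < t by rewrite /t !divr_gt0.
have tr : t * (`|v| + `|w|) < r.
  have : t * (`|v| + `|w| + 1) = r / 2 by rewrite /t mulfVK ?gt_eqF.
  by lra.
have inP s s' : 0 <= s <= t -> 0 <= s' <= t -> P (a + s *: v + s' *: w).
  move=> /andP[s0 st] /andP[s'0 s't]; apply: rP; rewrite -ball_normE /=.
  rewrite -addrA opprD addrA subrr add0r normrN; apply: le_lt_trans tr.
  rewrite (le_trans (ler_normD _ _))// !normrZ !ger0_norm// mulrDr.
  by rewrite lerD// ler_wpM2r.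
have [|s1 [s1' [s1t s1't E1]]] := @MVT_line2 f a v w t (ltW t0).
  by move=> s s' st s't; have [] := inP _ _ st s't.
have [|s2 [s2' [s2t s2't E2]]] := @MVT_line2 f a w v t (ltW t0).
  move=> s s' st s't; rewrite addrAC; by have [] := inP _ _ s't st.
have [_ _ e1 _] := inP _ _ s1t s1't.
have [_ _ _ e2] := inP _ _ s2't s2t.
have EA : a + t *: w + t *: v = a + t *: v + t *: w by rewrite addrAC.
have EB : a + s2' *: v + s2 *: w = a + s2 *: w + s2' *: v by rewrite addrAC.
rewrite EB in e2; rewrite EA in E2; move: E1 E2 e1 e2.
move: ('D_w ('D_v f) a) ('D_v ('D_w f) a) => p q.
move: ('D_w ('D_v f) _) ('D_v ('D_w f) _) => p' q'.
move: (f _) (f _) (f _) (f _) => A B C D E1 E2 e1 e2.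
have E : p' = q'.
  have tn0 : t != 0 by rewrite gt_eqF.
  by apply: (mulIf tn0); apply: (mulIf tn0); rewrite -E1 -E2; ring.
rewrite [leRHS]splitr (le_trans _ (lerD e1 e2))//.
by rewrite -E (distrC q); apply: (ler_distD p').
Qed.

End LineCalculus.

(** * Clarke subdifferentials *)

Section Clarke.
Context {R : realType} {n : nat}.
Implicit Types (h : 'rV[R]_n -> R) (x z d : 'rV[R]_n).

Lemma dot_continuous d : continuous (fun z => dot z d).
Proof.
have cvg_idl (W : topologicalType) (a : W) : b @[b --> a] --> a by exact: cvg_id.
move=> z; exact: (cvg_dot (cvg_idl _ z) (cvg_cst d)).
Qed.

(** The bound is an extended real because the limsup defining the Clarke derivative may be
    infinite. *)
Lemma closed_halfspace d (c : \bar R) : closed [set z | ((dot z d)%:E <= c)%E].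
Proof.
case: c => [r| |].
- rewrite (_ : [set z | _] = (fun z => dot z d) @^-1` [set s | s <= r]); last first.
    by apply/seteqP; split => z /=; rewrite lee_fin.
  apply: preimage_closed; last exact: closed_le.
  by move=> z _; exact: dot_continuous.
- rewrite (_ : [set z | _] = setT); first exact: closedT.
  by apply/seteqP; split => z //= _; rewrite leey.
- rewrite (_ : [set z | _] = set0); first exact: closed0.
  by apply/seteqP; split => z //=; rewrite leeNy_eq.
Qed.

Lemma closed_clarke h x : closed (clarke h x).
Proof.
pose c d := limf_esup (fun p : 'rV[R]_n * R =>
  ((h (p.1 + p.2 *: d) - h p.1) / p.2)%R%:E) (filter_prod (nbhs x) (0 : R)^'+).
rewrite (_ : clarke h x = \bigcap_d [set z | ((dot z d)%:E <= c d)%E]).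
  by apply: closed_bigI => d _; exact: closed_halfspace.
by apply/seteqP; split => z zh d; [move=> _; exact: zh|exact: zh].
Qed.

Lemma segment_closed_clarke h x : segment_closed (clarke h x).
Proof.
move=> z1 z2 t c1 c2 /andP[t0 t1] d; have := c1 d; have := c2 d.
case: (limf_esup _ _) => [r| |]; rewrite ?leey ?leeNy_eq// !lee_fin !dotE.
nra.
Qed.

(** Every neighborhood in the limsup contains the base point [x] itself, so quotients based at [x]
    already bound it from below. *)
Lemma clarkeI h x z :
  (forall d (e : R), 0 < e ->
    \forall t \near (0 : R)^'+, dot z d - e <= (h (x + t *: d) - h x) / t) ->
  clarke h x z.
Proof.
move=> H d; apply: le_ereal_inf_tmp => _ [W [[A B] [/= nA nB] AB] <-].
apply/lee_addgt0Pr => e e0; rewrite -leeBlDr// -EFinB.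
have [t [Bt dt]] : exists t, B t /\ dot z d - e <= (h (x + t *: d) - h x) / t.
  by have [t [Bt dt]] := filter_ex (filterI nB (H d e e0)); exists t.
apply: (@le_trans _ _ ((h (x + t *: d) - h x) / t)%:E); first by rewrite lee_fin.
apply: ereal_sup_ubound; exists (x, t) => //.
by apply: AB; split => //=; exact: nbhs_singleton.
Qed.

(** A bound valid on one set of the filter bounds the supremum over that set, hence the limsup,
    which is an infimum of such suprema. *)
Lemma clarke_dot_le h x z d (M : R) : clarke h x z ->
  (forall e : R, 0 < e -> \forall p \near filter_prod (nbhs x) (0 : R)^'+,
    (h (p.1 + p.2 *: d) - h p.1) / p.2 <= M + e) ->
  dot z d <= M.
Proof.
move=> zh H; apply/ler_addgt0Pr => e e0; rewrite -lee_fin.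
apply: le_trans (zh d) _.
apply: (@le_trans _ _ (ereal_sup ((fun p : 'rV[R]_n * R =>
    ((h (p.1 + p.2 *: d) - h p.1) / p.2)%:E) @`
    [set p | (h (p.1 + p.2 *: d) - h p.1) / p.2 <= M + e]))).
  apply: ereal_inf_lbound.
  by exists [set p | (h (p.1 + p.2 *: d) - h p.1) / p.2 <= M + e]; first exact: H.
by apply: ge_ereal_sup => _ [p /= pM <-]; rewrite lee_fin.
Qed.

(* The direction [z - b] separates [z] from the closed convex set [clarke h2 x]. *)
Lemma excess_clarke_le (h1 h2 : 'rV[R]_n -> R) x (r : R) :
  clarke h2 x !=set0 ->
  (forall z b, clarke h1 x z -> is_proj (clarke h2 x) z b ->
    dot z (z - b) <= dot b (z - b) + r * enorm (z - b)) ->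
  0 <= r -> (excess (clarke h1 x) (clarke h2 x) <= r%:E)%E.
Proof.
move=> ne H r0; apply: ge_ereal_sup => _ [z zh <-].
have [b pb] := is_proj_ex z ne (@closed_clarke h2 x) (@segment_closed_clarke h2 x).
apply: (@le_trans _ _ (enorm (z - b))%:E).
  by apply: ereal_inf_lbound; exists b => //; case: pb.
rewrite lee_fin; have := H _ _ zh pb.
have [->//|b0] := eqVneq (enorm (z - b)) 0.
have {}b0 : 0 < enorm (z - b) by rewrite lt_def b0 enorm_ge0.
rewrite -lerBlDl -dotNl -dotDl -sqr_enorm expr2.
by rewrite ler_pM2r.
Qed.

End Clarke.

(** * The proximal model *)

Section PartialGradients.
Context {R : realType} {n m : nat}.
Implicit Types (f : 'rV[R]_n * 'rV[R]_m -> R) (p : 'rV[R]_n * 'rV[R]_m).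
Implicit Types (x d : 'rV[R]_n) (y w : 'rV[R]_m).

Lemma addr_scale_inl x y d (t : R) : (x, y) + t *: (d, 0) = (x + t *: d, y).
Proof. by congr (_, _); rewrite /= scaler0 addr0. Qed.

Lemma addr_scale_inr x y w (t : R) : (x, y) + t *: (0, w) = (x, y + t *: w).
Proof. by congr (_, _); rewrite /= scaler0 addr0. Qed.

Lemma derive_sum_delta_x f p d : differentiable f p ->
  'D_(d, 0) f p = \sum_i d 0 i * 'D_(delta_mx 0 i, 0) f p.
Proof.
move=> fp.
have -> : (d, 0) = \sum_i d 0 i *: (delta_mx 0 i, 0) :> 'rV[R]_n * 'rV[R]_m.
  rewrite [in LHS](row_sum_delta d) /=.
  by elim/big_rec2: _ => // i a b _ <-; congr (_, _); rewrite /= scaler0 addr0.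
rewrite deriveE// linear_sum; apply: eq_bigr => i _.
by rewrite linearZ deriveE.
Qed.

Lemma derive_sum_delta_y f p w : differentiable f p ->
  'D_(0, w) f p = \sum_j w 0 j * 'D_(0, delta_mx 0 j) f p.
Proof.
move=> fp.
have -> : (0, w) = \sum_i w 0 i *: (0, delta_mx 0 i) :> 'rV[R]_n * 'rV[R]_m.
  rewrite [in LHS](row_sum_delta w) /=.
  by elim/big_rec2: _ => // i a b _ <-; congr (_, _); rewrite /= scaler0 addr0.
rewrite deriveE// linear_sum; apply: eq_bigr => i _.
by rewrite linearZ deriveE.
Qed.

Lemma derive_gradx f p d : differentiable f p -> 'D_(d, 0) f p = dot (gradx f p) d.
Proof.
move=> fp; rewrite derive_sum_delta_x//; apply: eq_bigr => i _.
by rewrite mxE mulrC.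
Qed.

Lemma derive_grady f p w : differentiable f p -> 'D_(0, w) f p = dot (grady f p) w.
Proof.
move=> fp; rewrite derive_sum_delta_y//; apply: eq_bigr => i _.
by rewrite mxE mulrC.
Qed.

Lemma dot_row_mx (u u' : 'rV[R]_n) (v v' : 'rV[R]_m) :
  dot (row_mx u v) (row_mx u' v') = dot u u' + dot v v'.
Proof.
rewrite /dot big_split_ord/=; congr (_ + _); apply: eq_bigr => i _.
  by rewrite !row_mxEl.
by rewrite !row_mxEr.
Qed.

Lemma enorm_row_mxl (u : 'rV[R]_n) (v : 'rV[R]_m) : enorm u <= enorm (row_mx u v).
Proof. by rewrite ler_wsqrtr// dot_row_mx lerDl dot_ge0. Qed.

Lemma enorm_row_mxr (u : 'rV[R]_n) (v : 'rV[R]_m) : enorm v <= enorm (row_mx u v).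
Proof. by rewrite ler_wsqrtr// dot_row_mx lerDr dot_ge0. Qed.

Lemma pnorm_inr (w : 'rV[R]_m) : pnorm (0 : 'rV[R]_n, w) = enorm w.
Proof.
rewrite /pnorm /enorm dot_row_mx; congr Num.sqrt.
by rewrite -(scale0r 0) dotZl mul0r add0r.
Qed.

End PartialGradients.

Lemma sup_max {R : realType} (A : set R) (a : R) : A a -> ubound A a -> sup A = a.
Proof.
move=> Aa ubA; apply/eqP; rewrite eq_le ge_sup//=; last by exists a.
by apply: ub_le_sup => //; exists a.
Qed.

Section Model.
Context {R : realType} {n m : nat}.
Variables (f : 'rV[R]_n * 'rV[R]_m -> R) (Y : set 'rV[R]_m) (Lhat : R).
Hypotheses (Y_neq0 : Y !=set0) (Y_closed : closed Y) (Y_seg : segment_closed Y).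
Hypothesis (Lhat_gt0 : 0 < Lhat).
Implicit Types (x : 'rV[R]_n) (y z : 'rV[R]_m).

Definition model x y z :=
  f (x, y) + (dot (grady f (x, y)) (z - y) - Lhat / 2 * enorm (z - y) ^+ 2).

(** Completing the square in [model] shows that maximizing it over [Y] amounts to projecting a
    gradient step of length [Lhat^-1]. *)
Definition model_argmax x y := nearest Y (y + Lhat^-1 *: grady f (x, y)).

Lemma model_argmaxP x y : is_proj Y (y + Lhat^-1 *: grady f (x, y)) (model_argmax x y).
Proof. exact: nearestP. Qed.

(** Feasibility comes from the projection property, so the maximizer can serve as a test point in
    [Y]. *)
Lemma model_argmaxY x y : Y (model_argmax x y).
Proof. by case: (model_argmaxP x y). Qed.

Lemma model_le x y z : Y z -> model x y z <= model x y (model_argmax x y).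
Proof.
move=> Yz; have [_ /(_ _ Yz)] := model_argmaxP x y.
move: (model_argmax x y) => b.
rewrite /model lerD2l (_ : z - y = (b - y) + (z - b)); last first.
  by rewrite [RHS]addrC addrA subrK.
rewrite (_ : y + _ - b = Lhat^-1 *: (grady f (x, y) - Lhat *: (b - y))); last first.
  rewrite scalerBr scalerA mulVf ?gt_eqF// scale1r opprB.
  by rewrite addrCA addrA.
(* Writing [g], [p], [r] for the gradient, [b - y] and [z - b], the model changes from [b] to [z] by
   [dot (g - Lhat *: p) r - Lhat / 2 * dot r r]; the projection inequality makes the first term
   nonpositive. *)
rewrite dotZl pmulr_rle0 ?invr_gt0// !sqr_enorm.
have := mulr_ge0 (ltW Lhat_gt0) (dot_ge0 (z - b)).
move: (grady f _) (b - y) (z - b) => g p r.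
by rewrite !dotE (dotC r p); lra.
Qed.

Lemma q_model x y : q f Y Lhat x y = model x y (model_argmax x y).
Proof.
rewrite /q /model; congr (_ + _); apply: sup_max.
  by exists (model_argmax x y) => //; exact: model_argmaxY.
by move=> _ [z Yz <-]; have := model_le x y Yz; rewrite lerD2l.
Qed.

Lemma model_le_q x y z : Y z -> model x y z <= q f Y Lhat x y.
Proof. by rewrite q_model; exact: model_le. Qed.

End Model.

(** * Quadratic growth and the error bound *)

Section FixedX.
Context {R : realType} {n m : nat}.
Variables (f : 'rV[R]_n * 'rV[R]_m -> R) (Y : set 'rV[R]_m) (L : R) (x : 'rV[R]_n).
Hypotheses (Y_neq0 : Y !=set0) (Y_compact : compact Y) (Y_seg : segment_closed Y).
Hypothesis (f_diff : forall y, Y y -> differentiable f (x, y)).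
Hypothesis (L_gt0 : 0 < L).
Hypothesis (grad_lip : forall y y', Y y -> Y y' ->
  enorm (grad f (x, y) - grad f (x, y')) <= L * enorm (y - y')).
Implicit Types (y z : 'rV[R]_m).

Lemma gradx_lip y y' : Y y -> Y y' ->
  enorm (gradx f (x, y) - gradx f (x, y')) <= L * enorm (y - y').
Proof.
move=> Yy Yy'; apply: le_trans (grad_lip Yy Yy').
by rewrite /grad opp_row_mx add_row_mx enorm_row_mxl.
Qed.

Lemma grady_lip y y' : Y y -> Y y' ->
  enorm (grady f (x, y) - grady f (x, y')) <= L * enorm (y - y').
Proof.
move=> Yy Yy'; apply: le_trans (grad_lip Yy Yy').
by rewrite /grad opp_row_mx add_row_mx enorm_row_mxr.
Qed.

Lemma cvg_fy y : Y y -> f (x, z) @[z --> y] --> f (x, y).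
Proof.
move=> Yy; have fc := differentiable_continuous (f_diff Yy).
have pc (W1 W2 : topologicalType) (a : W1) (b : W2) : (a, c) @[c --> b] --> (a, b).
  by apply: cvg_pair => /=; [exact: cvg_cst|exact: cvg_id].
exact: (cvg_comp _ _ (pc _ _ x y) fc).
Qed.

Lemma within_continuous_fy : {within Y, continuous (fun y => f (x, y))}.
Proof. by apply: continuous_in_subspaceT => y /set_mem Yy; exact: cvg_fy. Qed.

Lemma argmax_ex : exists2 y, Y y & forall z, Y z -> f (x, z) <= f (x, y).
Proof.
have [y /set_mem Yy H] := EVT_max_rV Y_neq0 Y_compact within_continuous_fy.
by exists y => // z Yz; apply: H; rewrite inE.
Qed.

Lemma le_V y : Y y -> f (x, y) <= V f Y x.
Proof.
move=> Yy; apply: ub_le_sup; last by exists y.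
have [y0 _ H] := argmax_ex; exists (f (x, y0)) => _ [z Yz <-]; exact: H.
Qed.

Lemma V_attained : exists2 y, Y y & f (x, y) = V f Y x.
Proof.
have [y Yy H] := argmax_ex; exists y => //; apply/esym/sup_max; first by exists y.
by move=> _ [z Yz <-]; exact: H.
Qed.

Lemma quadratic_bound y z : Y y -> Y z ->
  `|f (x, z) - f (x, y) - dot (grady f (x, y)) (z - y)| <=
    L / 2 * enorm (z - y) ^+ 2.
Proof.
move=> Yy Yz; set w := z - y; set g := dot _ w; set N := enorm w ^+ 2.
have Yt (t : R) : 0 <= t <= 1 -> Y (y + t *: w) by move=> ?; exact: Y_seg.
have der (t : R) : 0 <= t <= 1 -> is_derive t 1 (fun t => f (x, y + t *: w))
    (dot (grady f (x, y + t *: w)) w).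
  move=> t01; have ft := f_diff (Yt _ t01).
  have := @is_derive_line _ _ f (x, y) (0, w) t; rewrite addr_scale_inr.
  under eq_fun do rewrite addr_scale_inr.
  by rewrite derive_grady//; apply; exact: diff_derivable.
have derb (t : R) : 0 <= t <= 1 -> `|dot (grady f (x, y + t *: w)) w - g| <= L * t * N.
  move=> t01; rewrite /g -dotNl -dotDl.
  have : enorm (grady f (x, y + t *: w) - grady f (x, y)) <= L * t * enorm w.
    rewrite (le_trans (grady_lip (Yt _ t01) Yy))// [y + _]addrC addrK enormZ.
    by case/andP: t01 => t0 _; rewrite ger0_norm// mulrA.
  move: (_ - _) => G hG.
  have h v : dot G v <= enorm G * enorm v by exact: dot_le_enorm.
  have : enorm G * enorm w <= L * t * N.
    by rewrite /N expr2 mulrA ler_wpM2r ?enorm_ge0.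
  rewrite ler_norml => h1; apply/andP; split; last exact: le_trans (h w) h1.
  by rewrite lerNl -dotNr (le_trans (h _))// enormN.
have key (e : R) : e = 1 \/ e = -1 ->
    0 <= e * (f (x, z) - f (x, y) - g) + L / 2 * N.
  (* The quadratic term compensates the variation of the gradient, so that [phi] has nonnegative
     derivative for either sign [e]; comparing [phi] at 0 and 1 gives one side of the bound. *)
  move=> e1; pose phi (t : R) := e * (f (x, y + t *: w) - t * g) + L / 2 * N * t ^+ 2.
  pose dphi (t : R) := e * (dot (grady f (x, y + t *: w)) w - g) + L * N * t.
  have dphiP (t : R) : 0 <= t <= 1 -> is_derive t 1 phi (dphi t).
    move=> t01; have d1 := der _ t01.
    by apply: is_derive_eq; rewrite /dphi /GRing.scale /=; field.
  have [|||c c01] := @MVT_segment R phi dphi 0 1.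
  - exact: ler01.
  - by move=> t; rewrite in_itv/= => /andP[/ltW t0 /ltW t1]; apply: dphiP; rewrite t0.
  - apply: derivable_within_continuous => t; rewrite in_itv/= => t01.
    by have [] := dphiP _ t01.
  rewrite in_itv/= in c01; rewrite subr0 mulr1 /phi scale1r scale0r addr0 mul1r mul0r.
  rewrite expr1n expr0n/= !mulr1 mulr0 addr0 subr0 addrC /w addrC.
  rewrite (_ : y + (z - y) = z); last by rewrite addrC subrK.
  have : 0 <= dphi c.
    have := derb _ c01; rewrite /dphi ler_norml => /andP[].
    by case: e1 => ->; lra.
  by rewrite -/w; lra.
have k1 := key 1 (or_introl erefl); have k2 := key (-1) (or_intror erefl).
by rewrite ler_norml; apply/andP; split; lra.
Qed.

(** [quadratic_bound] makes [t * dot (grady f (x, y)) (z - y)] at most the increment of [f] plus a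
    term of order [t ^+ 2]; dividing by a small [t] leaves [A]. *)
Lemma first_order_le y z (A B : R) : Y y -> Y z ->
  (forall t : R, 0 < t <= 1 -> f (x, y + t *: (z - y)) - f (x, y) <= t * (A + t * B)) ->
  dot (grady f (x, y)) (z - y) <= A.
Proof.
move=> Yy Yz H; apply/ler_addgt0Pr => e e0.
pose K := B + L / 2 * enorm (z - y) ^+ 2.
(* This choice ensures both [0 < t <= 1] and [t * K <= e], where [K] collects all second-order
   terms. *)
pose t := e / (`|K| + e).
have Ke : 0 < `|K| + e by rewrite ltr_wpDl.
have t0 : 0 < t by rewrite divr_gt0.
have t1 : t <= 1 by rewrite ler_pdivrMr// mul1r lerDr.
have tK : t * K <= e.
  apply: (@le_trans _ _ (t * `|K|)); first by rewrite ler_wpM2l ?ler_norm// ltW.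
  by rewrite mulrAC ler_pdivrMr// ler_wpM2l ?ltW// ltrDl.
clearbody t; clear Ke.
have Yt : Y (y + t *: (z - y)) by apply: Y_seg => //; rewrite ltW.
have := quadratic_bound Yy Yt; rewrite [y + _]addrC addrK enormZ dotZr.
rewrite (ger0_norm (ltW t0)) exprMn ler_norml => /andP[+ _].
have := H t; rewrite t0 t1 => /(_ isT).
rewrite [y + _]addrC; move: (f _ - f _) => F.
move: (dot _ _) @K tK => g; move: (enorm _ ^+ 2) => N /= tK h1 h2.
rewrite -(ler_pM2l t0); nra.
Qed.

Lemma V_first_order y z : Y y -> f (x, y) = V f Y x -> Y z ->
  dot (grady f (x, y)) (z - y) <= 0.
Proof.
move=> Yy yV Yz; apply: (@first_order_le _ _ 0 0) => // t /andP[t0 t1].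
rewrite mulr0 addr0 mulr0 subr_le0 yV; apply: le_V.
by apply: Y_seg => //; rewrite ltW.
Qed.

(** By concavity the square root lies below its tangent at [b ^+ 2]. This replaces differentiation
    of square roots in the quadratic growth argument. *)
Lemma sqrt_le_tangent (a b : R) : 0 < b -> 0 <= a ->
  Num.sqrt a <= (a + b ^+ 2) / (2 * b).
Proof.
move=> b0 a0; rewrite ler_pdivlMr ?mulr_gt0//.
have := sqr_ge0 (Num.sqrt a - b); have := sqr_sqrtr a0; nra.
Qed.

(** The first-order condition puts [grady f (x, y) + C *: (z - y)] in the normal cone, so
    [C *: (z - y)] belongs to the set in the PL condition and its norm bounds the distance. *)
Lemma PL_first_order_gap (kp C : R) y z : 0 <= C -> Y y ->
  kp * (V f Y x - f (x, y)) <=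
    Defs.edist 0 [set - grady f (x, y) + xi | xi in normal_cone Y y] ^+ 2 ->
  (forall y', Y y' ->
    dot (grady f (x, y)) (y' - y) <= - (C * dot (z - y) (y' - y))) ->
  kp * (V f Y x - f (x, y)) <= (C * enorm (z - y)) ^+ 2.
Proof.
move=> C0 Yy PLy H; apply: le_trans PLy _.
set S := [set _ | _ in _].
have S0 : lbound [set enorm (0 - s) | s in S] 0.
  by move=> _ [s _ <-]; exact: enorm_ge0.
have Sw : [set enorm (0 - s) | s in S] (C * enorm (z - y)).
  exists (C *: (z - y)); last by rewrite sub0r enormN enormZ ger0_norm.
  exists (grady f (x, y) + C *: (z - y)); last by rewrite addKr.
  by move=> y' /H; rewrite !dotE; lra.
have edist_ge0 : 0 <= Defs.edist 0 S.
  by apply: lb_le_inf S0; exists (C * enorm (z - y)).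
rewrite ler_pXn2r// ?nnegrE ?mulr_ge0 ?enorm_ge0//.
by apply: ge_inf Sw; exists 0.
Qed.

(* Ekeland-type argument: minimize the square root of the gap plus a smoothed
   multiple of the distance to [z]; PL forces the minimizer to be a maximizer
   of [f (x, _)]. *)
Lemma PL_quadratic_growth (kp : R) z : 0 < kp ->
  (forall y, Y y -> kp * (V f Y x - f (x, y)) <=
    Defs.edist 0 [set - grady f (x, y) + xi | xi in normal_cone Y y] ^+ 2) ->
  Y z -> exists y, [/\ Y y, f (x, y) = V f Y x &
    kp / 8 * enorm (z - y) ^+ 2 <= V f Y x - f (x, z)].
Proof.
move=> kp0 PLx Yz.
have [zV|zV] := eqVneq (f (x, z)) (V f Y x).
  by exists z; split => //; rewrite zV !subrr enorm0 expr0n mulr0.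
pose gap y := V f Y x - f (x, y).
have gap_ge0 y : Y y -> 0 <= gap y by move=> Yy; rewrite subr_ge0 le_V.
have gz : 0 < gap z by rewrite lt_def gap_ge0// subr_eq0 eq_sym zV.
pose h := Num.sqrt (gap z); have h0 : 0 < h by rewrite sqrtr_gt0.
have hh : h ^+ 2 = gap z by rewrite sqr_sqrtr// ltW.
pose k := Num.sqrt kp; have k0 : 0 < k by rewrite sqrtr_gt0.
have kk : k ^+ 2 = kp by rewrite sqr_sqrtr// ltW.
(* Since [4 * c ^+ 2 = 16 / 25 * kp < kp], PL fails at a stationary point that is not a maximizer.
   With [e] below, comparison with [z] gives [k * s y <= 14 / 5 * h], and the square of [14 / 5] is
   less than 8. *)
pose c := 2 / 5 * k; have c0 : 0 < c by rewrite mulr_gt0// divr_gt0.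
pose e := 3 / 10 * (h / k).
have e0 : 0 < e by rewrite mulr_gt0// divr_gt0.
(* The smoothing keeps [s] positive, so its tangent estimate remains valid even if the minimizer is
   [z]. *)
pose s y := Num.sqrt (e ^+ 2 + enorm (z - y) ^+ 2).
have se y : 0 < e ^+ 2 + enorm (z - y) ^+ 2 by rewrite ltr_pwDl ?exprn_gt0// sqr_ge0.
have s0 y : 0 < s y by rewrite sqrtr_gt0.
have ss y : s y ^+ 2 = e ^+ 2 + enorm (z - y) ^+ 2 by rewrite sqr_sqrtr// ltW.
have Phic : {within Y, continuous (fun y => Num.sqrt (gap y) + c * s y)}.
  apply: continuous_in_subspaceT => y /set_mem Yy.
  have cvgPhi (T : Type) (F : set_system T) (FF : Filter F) (fT eT : T -> R) :
      fT t @[t --> F] --> f (x, y) -> eT t @[t --> F] --> enorm (z - y) ->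
      Num.sqrt (V f Y x - fT t) + c * Num.sqrt (e ^+ 2 + eT t ^+ 2) @[t --> F]
        --> Num.sqrt (gap y) + c * s y.
    have sqrtc (g : T -> R) (a : R) : g t @[t --> F] --> a ->
        Num.sqrt (g t) @[t --> F] --> Num.sqrt a.
      by move=> ga; apply: (cvg_comp _ _ ga); exact: sqrt_continuous.
    move=> fc ec; apply: cvgD.
      by apply: sqrtc; apply: cvgB => //; exact: cvg_cst.
    apply: cvgMr; apply: sqrtc; apply: cvgD; first exact: cvg_cst.
    by rewrite expr2; under eq_fun do rewrite expr2; apply: cvgM.
  exact: (cvgPhi _ (nbhs y) (nbhs_filter y) _ _ (cvg_fy Yy) (@cvg_enorm_sub _ _ z y)).
have [y /set_mem Yy ymin] := EVT_min_rV Y_neq0 Y_compact Phic.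
have Gy := gap_ge0 _ Yy.
exists y.
have y_opt : gap y = 0.
  have [//|Gn0] := eqVneq (gap y) 0.
  have G0 : 0 < gap y by rewrite lt_def Gn0.
  pose g0 := Num.sqrt (gap y); have g00 : 0 < g0 by rewrite sqrtr_gt0.
  have gg : g0 ^+ 2 = gap y by rewrite sqr_sqrtr.
  (* Formally, stationarity of [Num.sqrt (gap y) + c * s y] reads
     [grady f (x, y) = - (2 * r) *: (z - y)], up to the normal cone. *)
  pose r := g0 * c / s y.
  have r0 : 0 < r by rewrite divr_gt0// mulr_gt0.
  have rs : r * s y = g0 * c by rewrite /r mulfVK// gt_eqF.
  have : kp * gap y <= (2 * r * enorm (z - y)) ^+ 2.
    apply: PL_first_order_gap (PLx _ Yy) _ => //; first by rewrite mulr_ge0// ltW.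
    move=> y' Yy'.
    apply: (@first_order_le _ _ _ (r * enorm (y' - y) ^+ 2)) => // t t01.
    have Yt : Y (y + t *: (y' - y)).
      by apply: Y_seg => //; case/andP: t01 => /ltW -> ->.
    have h1 := sqrt_le_tangent g00 (gap_ge0 _ Yt).
    have h2 := sqrt_le_tangent (s0 y) (ltW (se (y + t *: (y' - y)))).
    have E : enorm (z - (y + t *: (y' - y))) ^+ 2 = enorm (z - y) ^+ 2
        - 2 * t * dot (z - y) (y' - y) + t ^+ 2 * enorm (y' - y) ^+ 2.
      rewrite opprD addrA !sqr_enorm; move: (z - y) (y' - y) => p q.
      by rewrite !dotE (dotC q p); ring.
    have := ymin _ (mem_set Yt); rewrite -/g0.
    move: h1 h2; rewrite !ler_pdivlMr ?mulr_gt0// -/(s _).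
    rewrite /gap E ss gg; move: (Num.sqrt (_ - _)) (s (y + _)) => a b h1 h2 h3.
    have h4 := ler_wpM2l (ltW r0) h2.
    (* Combining the minimality of [y] with the two tangent bounds leaves an increment of [f] at
       most [r] times the decrease [s y ^+ 2 - s (y + t *: (y' - y)) ^+ 2] with reversed sign, which
       is quadratic in [t]. *)
    have h5 := ler_wpM2l (ltW g00) h3.
    have E1 : g0 * (c * s y) = r * s y ^+ 2 by rewrite mulrA -rs expr2 mulrA.
    have E2 : g0 * (c * b) = r * s y * b by rewrite mulrA -rs.
    move: h1 h4 h5; rewrite !mulrDr E1 E2 ss -expr2 gg /gap; lra.
  have Ds : (2 * r * enorm (z - y)) ^+ 2 <= 16 / 25 * (kp * gap y).
    have -> : 16 / 25 * (kp * gap y) = (2 * (r * s y)) ^+ 2.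
      by rewrite rs -gg -kk /c; field.
    clearbody r e; rewrite !exprMn ss.
    by have := mulr_ge0 (sqr_ge0 r) (sqr_ge0 e); lra.
  by have := mulr_gt0 kp0 G0; lra.
split => //; first by apply/eqP; rewrite eq_sym -subr_eq0; apply/eqP.
have := ymin _ (mem_set Yz); rewrite y_opt sqrtr0 add0r -/h.
have -> : s z = e by rewrite /s subrr enorm0 expr0n addr0 sqrtr_sqr gtr0_norm.
have -> : c * e = 3 / 25 * h by rewrite /c /e; field; rewrite gt_eqF.
move=> cs; have ks : k * s y <= 14 / 5 * h by move: cs; rewrite /c; lra.
have ks2 : k ^+ 2 * s y ^+ 2 <= (14 / 5 * h) ^+ 2.
  by rewrite -exprMn ler_pXn2r ?nnegrE ?mulr_ge0 ?divr_ge0// ltW.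
rewrite -/(gap z) -hh -kk; clearbody e h k; move: ks2; rewrite ss exprMn.
have : 0 <= k ^+ 2 * e ^+ 2 by rewrite mulr_ge0 ?sqr_ge0.
by have := sqr_ge0 h; lra.
Qed.

Variable Lhat : R.
Hypothesis Lhat_gt : L < Lhat.

Let Lhat_gt0 : 0 < Lhat := lt_trans L_gt0 Lhat_gt.
Let Y_closed : closed Y := compact_closed (@norm_hausdorff _ _) Y_compact.

Local Notation zhat := (model_argmax f Y Lhat x).

Let zhatY y : Y (zhat y).
Proof. exact: model_argmaxY. Qed.

(** At the maximizer of the model, [f] lies above its linearization minus the [L / 2] quadratic,
    while the model subtracts the [Lhat / 2] quadratic. *)
Lemma q_le y : Y y ->
  q f Y Lhat x y <= f (x, zhat y) - (Lhat - L) / 2 * enorm (zhat y - y) ^+ 2.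
Proof.
move=> Yy; rewrite q_model// /model.
by have := quadratic_bound Yy (zhatY y); rewrite ler_norml => /andP[+ _]; lra.
Qed.

(** Testing the model at [z] loses at most [(L + Lhat) / 2] times the squared distance, and
    [L < Lhat]. *)
Lemma le_q y z : Y y -> Y z -> f (x, z) - Lhat * enorm (z - y) ^+ 2 <= q f Y Lhat x y.
Proof.
move=> Yy Yz; apply: le_trans (model_le_q f Y_neq0 Y_closed Y_seg Lhat_gt0 x y Yz).
have := quadratic_bound Yy Yz; rewrite ler_norml => /andP[_].
have := mulr_ge0 (_ : 0 <= Lhat - L) (sqr_ge0 (enorm (z - y))).
rewrite subr_ge0 (ltW Lhat_gt) => /(_ isT).
by rewrite /model; lra.
Qed.

(** A maximizer [ybar] is fixed by the projected gradient step. Nonexpansiveness gives [enorm (zhat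
    y - ybar) <= (1 + L / Lhat) * enorm (y - ybar)], and the triangle inequality adds one more
    distance. *)
Lemma zhat_dist y ybar : Y y -> Y ybar -> f (x, ybar) = V f Y x ->
  enorm (zhat y - y) <= (2 + L / Lhat) * enorm (y - ybar).
Proof.
move=> Yy Yb bV.
have pb : is_proj Y (ybar + Lhat^-1 *: grady f (x, ybar)) ybar.
  split => // z Yz; rewrite [ybar + _]addrC addrK dotZl.
  by rewrite pmulr_rle0 ?invr_gt0// V_first_order.
have := is_proj_nonexpansive (model_argmaxP f Lhat Y_neq0 Y_closed Y_seg x y) pb.
rewrite opprD addrACA -scalerBr.
move=> h; have {h} := le_trans h (ler_enormD _ _).
rewrite enormZ gtr0_norm ?invr_gt0// => h.
have {h} : enorm (zhat y - ybar) <= enorm (y - ybar) + L / Lhat * enorm (y - ybar).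
  rewrite (le_trans h)// lerD2l mulrAC mulrC ler_wpM2r ?invr_ge0 ?(ltW Lhat_gt0)//.
  exact: grady_lip.
have := ler_enormB_add ybar (zhat y) y; rewrite (enorm_distC ybar y); lra.
Qed.

(* The constant is the harmonic combination of the growth constants
   [(Lhat - L) / 2] (strong concavity of the model) and [kp / 8] (PL). *)
Lemma q_error_bound (kp rho : R) y : 0 < kp ->
  (forall y, Y y -> kp * (V f Y x - f (x, y)) <=
    Defs.edist 0 [set - grady f (x, y) + xi | xi in normal_cone Y y] ^+ 2) ->
  Y y -> 0 <= rho -> V f Y x - q f Y Lhat x y <= Lhat * rho ^+ 2 ->
  exists ybar, [/\ Y ybar, f (x, ybar) = V f Y x &
    enorm (y - ybar) <=
      Num.sqrt (Lhat / (kp * (Lhat - L) / (2 * kp + 8 * (Lhat - L)))) * rho].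
Proof.
move=> kp0 PLx Yy rho0 Vq.
(* Growth is used at [zhat y], since [q_le] controls the gap of [f] there; strong concavity then
   covers the remaining distance from [zhat y] to [y]. *)
have [ybar [Yb bV growth]] := PL_quadratic_growth kp0 PLx (zhatY y).
exists ybar; split => //.
have LL : 0 < Lhat - L by rewrite subr_gt0.
have den0 : 0 < 2 * kp + 8 * (Lhat - L) by rewrite addr_gt0 ?mulr_gt0.
have q0 : 0 < kp * (Lhat - L) / (2 * kp + 8 * (Lhat - L)).
  by rewrite divr_gt0// mulr_gt0.
set kq := _ / _ in q0 *.
have kqE : kq * (2 * kp + 8 * (Lhat - L)) = kp * (Lhat - L).
  by rewrite /kq mulfVK// gt_eqF.
have s0 : 0 <= Num.sqrt (Lhat / kq) * rho by rewrite mulr_ge0 ?sqrtr_ge0.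
rewrite -(@ler_pXn2r _ 2) ?nnegrE ?enorm_ge0// exprMn.
rewrite (@sqr_sqrtr _ (Lhat / kq)); last by rewrite divr_ge0 ?ltW.
rewrite mulrAC ler_pdivlMr//; apply: le_trans Vq.
have h1 := q_le Yy; have h2 := ler_enormB_add (zhat y) y ybar.
rewrite (enorm_distC y (zhat y)) in h2.
apply: (@le_trans _ _ ((Lhat - L) / 2 * enorm (zhat y - y) ^+ 2 +
                       kp / 8 * enorm (zhat y - ybar) ^+ 2)); last lra.
rewrite mulrC.
have a0 := enorm_ge0 (zhat y - y); have b0 := enorm_ge0 (zhat y - ybar).
rewrite -(ler_pM2r den0) mulrAC kqE.
apply: (@le_trans _ _
    (kp * (Lhat - L) * (enorm (zhat y - y) + enorm (zhat y - ybar)) ^+ 2)).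
  rewrite ler_wpM2l ?mulr_ge0 ?(ltW kp0) ?(ltW LL)//.
  by rewrite ler_pXn2r ?nnegrE ?addr_ge0 ?enorm_ge0//.
(* This square is exactly the difference of the two sides. *)
have := sqr_ge0 (kp * enorm (zhat y - ybar) / 2 - 2 * (Lhat - L) * enorm (zhat y - y)).
lra.
Qed.

End FixedX.

(** * Directional derivatives of the model *)

Section TwiceDifferentiable.
Context {R : realType} {n m : nat}.
Variables (f : 'rV[R]_n * 'rV[R]_m -> R) (U : set ('rV[R]_n * 'rV[R]_m)).
Hypotheses (U_open : open U) (f_C2 : C2_on U f).
Implicit Types (a v w : 'rV[R]_n * 'rV[R]_m).

Let near_U a : U a -> \forall p \near a, U p.
Proof. by move=> Ua; exact: open_nbhs_nbhs. Qed.

Lemma C2_derive_sym a v w : U a -> 'D_w ('D_v f) a = 'D_v ('D_w f) a.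
Proof.
have near_D v' w' : U a -> \forall p \near a,
    derivable f p v' /\ derivable ('D_v' f) p w'.
  move=> /near_U; apply: filterS => p /f_C2[fp Dfp _].
  by split; exact: diff_derivable.
move=> Ua; apply: derive_sym; [exact: near_D|exact: near_D| |].
- by have [_ _] := f_C2 Ua.
- by have [_ _] := f_C2 Ua.
Qed.

Context {T : Type} (F : set_system T) {FF : Filter F}.
Variables (h : T -> 'rV[R]_n * 'rV[R]_m) (tau : T -> R) (a : 'rV[R]_n * 'rV[R]_m).
Hypotheses (ha : h t @[t --> F] --> a) (tau0 : tau t @[t --> F] --> 0).
Hypotheses (tau_gt0 : \forall t \near F, 0 < tau t) (Ua : U a).

Lemma C2_cvg_quotient v :
  (f (h t + tau t *: v) - f (h t)) / tau t @[t --> F] --> 'D_v f a.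
Proof.
apply: cvg_diff_quotient => //.
  by apply: filterS (near_U Ua) => p /f_C2[fp _ _]; exact: diff_derivable.
by have [_ Dfp _] := f_C2 Ua; exact: (differentiable_continuous (Dfp _)).
Qed.

Lemma C2_cvg_quotient2 v w :
  ('D_v f (h t + tau t *: w) - 'D_v f (h t)) / tau t @[t --> F] --> 'D_w ('D_v f) a.
Proof.
apply: cvg_diff_quotient => //.
  by apply: filterS (near_U Ua) => p /f_C2[_ Dfp _]; exact: diff_derivable.
by have [_ _] := f_C2 Ua.
Qed.

Lemma C2_cvg_grady : grady f (h t) @[t --> F] --> grady f a.
Proof.
have [_ Dfp _] := f_C2 Ua.
have Dc j : grady f (h t) 0 j @[t --> F] --> grady f a 0 j.
  rewrite mxE; under eq_fun do rewrite mxE.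
  apply: (@cvg_comp _ _ _ h ('D_(0, delta_mx 0 j) f) F _ _ ha).
  exact: (differentiable_continuous (Dfp _)).
have : enorm (grady f a - grady f (h t)) @[t --> F] --> 0.
  rewrite -(enorm0 (R := R) (n := m)) /enorm.
  apply: (@cvg_comp _ _ _
    (fun t => dot (grady f a - grady f (h t)) (grady f a - grady f (h t)))
    Num.sqrt _ (nbhs (dot 0 0))); last exact: sqrt_continuous.
  apply: cvg_big => [|j _]; first exact: add_continuous.
  have Dj : (grady f a - grady f (h t)) 0 j @[t --> F] --> (0 : 'rV[R]_m) 0 j.
    rewrite mxE -(subrr (grady f a 0 j)); under eq_fun do rewrite mxE [in X in _ + X]mxE.
    by apply: cvgB => //; exact: cvg_cst.
  exact: cvgM.
move=> /cvgrPdist_le hc; apply/cvgrPdist_le => e e0; apply: filterS (hc _ e0) => t.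
rewrite sub0r normrN ger0_norm ?enorm_ge0// => He.
exact: le_trans (mx_norm_le_enorm _) He.
Qed.

Lemma C2_cvg_f : f (h t) @[t --> F] --> f a.
Proof.
have [fa _ _] := f_C2 Ua.
by apply: (@cvg_comp _ _ _ h f F _ _ ha); exact: (differentiable_continuous fa).
Qed.

End TwiceDifferentiable.

(** * Continuity and one-sided variation of [q] in [x] *)

Section ModelVariation.
Context {R : realType} {n m : nat}.
Variables (f : 'rV[R]_n * 'rV[R]_m -> R) (Y : set 'rV[R]_m) (Lhat : R).
Variables (U : set ('rV[R]_n * 'rV[R]_m)).
Hypotheses (U_open : open U) (f_C2 : C2_on U f).
Hypotheses (Y_neq0 : Y !=set0) (Y_closed : closed Y) (Y_seg : segment_closed Y).
Hypothesis (Lhat_gt0 : 0 < Lhat).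
Variables (x d : 'rV[R]_n) (y : 'rV[R]_m).
Hypothesis (Uxy : U (x, y)).
Context {T : Type} (F : set_system T) {FF : Filter F}.

Let cvg_inl (h : T -> 'rV[R]_n) : h t @[t --> F] --> x -> (h t, y) @[t --> F] --> (x, y).
Proof.
have pc (W1 W2 : topologicalType) (g : T -> W1) (a : W1) (b : W2) :
    g t @[t --> F] --> a -> (g t, b) @[t --> F] --> (a, b).
  by move=> ga; apply: cvg_pair => //=; exact: cvg_cst.
exact: pc.
Qed.

Lemma cvg_model_argmax (h : T -> 'rV[R]_n) : h t @[t --> F] --> x ->
  model_argmax f Y Lhat (h t) y @[t --> F] --> model_argmax f Y Lhat x y.
Proof.
move=> hx; apply: cvg_nearest => //; apply: cvgD; first exact: cvg_cst.
by apply: cvgZl_tmp; exact: (C2_cvg_grady f_C2 (cvg_inl hx) Uxy).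
Qed.

Lemma cvg_q (h : T -> 'rV[R]_n) : h t @[t --> F] --> x ->
  q f Y Lhat (h t) y @[t --> F] --> q f Y Lhat x y.
Proof.
move=> hx; rewrite q_model//; under eq_fun do rewrite q_model//.
have zc : model_argmax f Y Lhat (h t) y - y @[t --> F] --> model_argmax f Y Lhat x y - y.
  by apply: cvgB; [exact: cvg_model_argmax|exact: cvg_cst].
apply: cvgD; first exact: (C2_cvg_f f_C2 (cvg_inl hx) Uxy).
apply: cvgB; first by apply: cvg_dot => //; exact: (C2_cvg_grady f_C2 (cvg_inl hx) Uxy).
have sqr_cvg (g : T -> R) (b : R) : g t @[t --> F] --> b ->
    Lhat / 2 * g t ^+ 2 @[t --> F] --> Lhat / 2 * b ^+ 2.
  by move=> gb; apply: cvgM; [exact: cvg_cst|exact: (cvgM gb gb)].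
exact: sqr_cvg (cvg_enorm zc).
Qed.

(* Danskin's theorem for the model, in the one-sided form needed for the Clarke
   directional derivative: compare both base points through the maximizer at the
   displaced one. *)
Lemma q_quotient_le (h : T -> 'rV[R]_n) (tau : T -> R) (e : R) :
  h t @[t --> F] --> x -> tau t @[t --> F] --> 0 -> (\forall t \near F, 0 < tau t) ->
  0 < e ->
  \forall t \near F,
    (q f Y Lhat (h t + tau t *: d) y - q f Y Lhat (h t) y) / tau t <=
    'D_(d, 0) f (x, y) +
    'D_(0, model_argmax f Y Lhat x y - y) ('D_(d, 0) f) (x, y) + e.
Proof.
move=> hx tau0 taugt0 e0.
have hx' : h t + tau t *: d @[t --> F] --> x.
  rewrite -[x in _ --> x]addr0 -(scale0r d); apply: cvgD => //.
  exact: cvgZr_tmp.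
pose z t := model_argmax f Y Lhat (h t + tau t *: d) y.
(* [B t] is the quotient of the model with its third argument frozen at [z t], so the quadratic term
   cancels. The sum over coordinates separates the quotients of fixed partial derivatives from the
   moving [z t]. *)
pose B t := (f ((h t, y) + tau t *: (d, 0)) - f (h t, y)) / tau t +
  \sum_j ('D_(0, delta_mx 0 j) f ((h t, y) + tau t *: (d, 0)) -
          'D_(0, delta_mx 0 j) f (h t, y)) / tau t * (z t - y) 0 j.
have Bcvg : B t @[t --> F] --> 'D_(d, 0) f (x, y) +
    'D_(0, model_argmax f Y Lhat x y - y) ('D_(d, 0) f) (x, y).
  apply: cvgD; first exact: (C2_cvg_quotient U_open f_C2 (cvg_inl hx)).
  have [_ Dfp _] := f_C2 Uxy.
  rewrite derive_sum_delta_y//; apply: cvg_big => [|j _]; first exact: add_continuous.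
  (* Symmetry is needed because the quotients differentiate the [y]-partials along [d], whereas the
     limit is stated with the derivatives in the other order. *)
  rewrite mulrC (C2_derive_sym U_open f_C2)//; apply: cvgM.
    exact: (C2_cvg_quotient2 U_open f_C2 (cvg_inl hx)).
  have zc : z t - y @[t --> F] --> model_argmax f Y Lhat x y - y.
    by apply: cvgB; [exact: cvg_model_argmax|exact: cvg_cst].
  by apply: (cvg_comp _ (fun A : 'rV[R]_m => A 0 j) zc); exact: coord_continuous.
have Ble : \forall t \near F, B t <= 'D_(d, 0) f (x, y) +
    'D_(0, model_argmax f Y Lhat x y - y) ('D_(d, 0) f) (x, y) + e.
  by apply: cvgr_le Bcvg _ _; rewrite ltrDl.
apply: filterS (filterI Ble taugt0) => t [Bt t0]; apply: le_trans Bt.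
have Yz : Y (z t) by exact: model_argmaxY.
have := model_le_q f Y_neq0 Y_closed Y_seg Lhat_gt0 (h t) y Yz.
rewrite [q f Y Lhat (_ + _) y]q_model// -/(z t) /B /model => Hq.
have -> : \sum_j ('D_(0, delta_mx 0 j) f ((h t, y) + tau t *: (d, 0)) -
    'D_(0, delta_mx 0 j) f (h t, y)) / tau t * (z t - y) 0 j =
    dot (grady f (h t + tau t *: d, y) - grady f (h t, y)) (z t - y) / tau t.
  rewrite /dot mulr_suml; apply: eq_bigr => j _.
  by rewrite mulrAC addr_scale_inl !mxE.
rewrite -mulrDl ler_wpM2r ?invr_ge0 ?(ltW t0)// addr_scale_inl dotDl dotNl.
by move: Hq; lra.
Qed.

End ModelVariation.

(** * Subgradients of the value functions *)

Lemma sup_ord_attained {R : realType} N (F : 'I_N -> R) : (0 < N)%N ->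
  exists j, sup [set F i | i in setT] = F j /\ forall i, F i <= F j.
Proof.
move=> N0.
case: (@Order.TotalTheory.arg_maxP _ _ _ (Ordinal N0) xpredT F isT) => j _ jmax.
exists j; split; last by move=> i; exact: jmax.
by apply: sup_max; [exists j|move=> _ [i _ <-]; exact: jmax].
Qed.

Lemma inf_ord_attained {R : realType} N (F : 'I_N -> R) : (0 < N)%N ->
  exists j, inf [set F i | i in setT] = F j /\ forall i, F j <= F i.
Proof.
move=> N0; have [j [jmax jle]] := sup_ord_attained (fun i => - F i) N0.
exists j; split; last by move=> i; rewrite -lerN2.
rewrite /inf; apply/eqP; rewrite eqr_oppLR -jmax; apply/eqP; congr sup.
apply/seteqP; split => [_ [_ [i _ <-] <-]|_ [i _ <-]]; first by exists i.
by exists (F i) => //; exists i.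
Qed.

Lemma beta_cover {R : realType} {m N} (Y : set 'rV[R]_m) (s : 'I_N -> 'rV[R]_m) y :
  (0 < N)%N -> compact Y -> Y y -> exists j, enorm (y - s j) <= beta Y s.
Proof.
move=> N0 Yc Yy.
have [j [jE _]] := inf_ord_attained (fun j => enorm (y - s j)) N0.
exists j; rewrite -jE; apply: ub_le_sup; last by exists y.
have j0 := Ordinal N0.
(* The distance to a single sample is bounded on [Y] and dominates the distance to the whole sample,
   so the supremum defining [beta] is that of a bounded set. *)
have [y0 /set_mem Yy0 ymax] : exists2 c, c \in Y &
    forall t, t \in Y -> enorm (s j0 - t) <= enorm (s j0 - c).
  apply: EVT_max_rV => //; first by exists y.
  exact/continuous_subspaceT/enorm_sub_continuous.
exists (enorm (s j0 - y0)) => _ [z Yz <-].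
have [i [-> imin]] := inf_ord_attained (fun j => enorm (z - s j)) N0.
by rewrite (le_trans (imin j0))// enorm_distC ymax// inE.
Qed.

Lemma beta_ge0 {R : realType} {m N} (Y : set 'rV[R]_m) (s : 'I_N -> 'rV[R]_m) :
  (0 < N)%N -> compact Y -> Y !=set0 -> 0 <= beta Y s.
Proof.
move=> N0 Yc [y Yy]; have [j] := beta_cover s N0 Yc Yy.
by apply: le_trans; exact: enorm_ge0.
Qed.

(** * Subgradients of [V] from maximizers *)

Section ClarkeOfMax.
Context {R : realType} {n m : nat}.
Variables (f : 'rV[R]_n * 'rV[R]_m -> R) (Y : set 'rV[R]_m).
Variables (U : set ('rV[R]_n * 'rV[R]_m)) (x : 'rV[R]_n).
Hypotheses (U_open : open U) (f_C2 : C2_on U f) (YU : forall y, Y y -> U (x, y)).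
Hypotheses (Y_neq0 : Y !=set0) (Y_compact : compact Y) (Y_seg : segment_closed Y).

Let f_diff y : Y y -> differentiable f (x, y).
Proof. by move=> /YU /f_C2[]. Qed.

(** Needed because [sup] takes a default value on unbounded sets and [x'] may leave the domain of
    the hypotheses. Compactness of [Y] makes the local bounds by [V f Y x + 1] uniform. *)
Lemma near_V_ubound : \forall x' \near x, has_ubound [set f (x', y) | y in Y].
Proof.
pose M := V f Y x + 1.
have near_M y : Y y -> \forall y' \near y & x' \near x, f (x', y') < M.
  move=> Yy.
  have fM : \forall p \near (x, y), f p < M.
    have fc := differentiable_continuous (f_diff Yy).
    apply: cvgr_lt fc _ _.
    by rewrite (le_lt_trans (le_V Y_neq0 Y_compact f_diff Yy))// ltrDl.
  case: fM => -[A B] /= [nA nB] AB; exists (B, A) => //=.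
  by move=> [y' x'] [By' Ax']; apply: (AB (x', y')).
have := (@compact_near_coveringP _ Y).1 Y_compact _ (nbhs x)
  (fun x' y' => f (x', y') < M) (nbhs_filter x) near_M.
apply: (@filterS _ (nbhs x) (nbhs_filter x)) => x' YM.
by exists M => _ [y Yy <-]; exact/ltW/YM.
Qed.

(** The function [f (_, y)] lies below [V] near [x] and touches it at [x], so quotients of [V] based
    at [x] dominate those of [f (_, y)]. *)
Lemma gradx_clarke_V y : Y y -> f (x, y) = V f Y x -> clarke (V f Y) x (gradx f (x, y)).
Proof.
move=> Yy yV; apply: clarkeI => d e e0.
have t0 : (t : R) @[t --> (0 : R)^'+] --> (0 : R) by exact: cvg_within.
have Ft : x + t *: d @[t --> (0 : R)^'+] --> x.
  rewrite -[x in _ --> x]addr0 -(scale0r d); apply: cvgD; first exact: cvg_cst.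
  exact: cvgZr_tmp.
have VU : \forall t \near (0 : R)^'+, has_ubound [set f (x + t *: d, y) | y in Y].
  exact: (Ft _ near_V_ubound).
have quot : (f ((x, y) + t *: (d, 0)) - f (x, y)) / t
    @[t --> (0 : R)^'+] --> 'D_(d, 0) f (x, y).
  apply: (C2_cvg_quotient U_open f_C2 (cvg_cst (x, y)) t0 _ (YU Yy)).
  exact: nbhs_right_gt.
have quot_ge : \forall t \near (0 : R)^'+,
    'D_(d, 0) f (x, y) - e <= (f ((x, y) + t *: (d, 0)) - f (x, y)) / t.
  by apply: cvgr_ge quot _ _; rewrite ltrBlDr ltrDl.
near=> t.
have tgt0 : 0 < t by near: t; exact: nbhs_right_gt.
have ub : has_ubound [set f (x + t *: d, y) | y in Y] by near: t.
rewrite -derive_gradx; last exact: f_diff.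
apply: (@le_trans _ _ ((f ((x, y) + t *: (d, 0)) - f (x, y)) / t)); first by near: t.
rewrite ler_wpM2r ?invr_ge0 ?(ltW tgt0)// yV lerD2r addr_scale_inl.
by apply: ub_le_sup => //; exists y.
Unshelve. all: by end_near. Qed.

End ClarkeOfMax.

Lemma diam_ge0 {R : realType} {m} (Y : set 'rV[R]_m) : 0 <= diam Y.
Proof.
rewrite /diam.
(* If the set of distances has no supremum, [sup] is 0 by convention. *)
have [ys|/sup_out ->//] :=
  pselect (has_sup [set enorm (p.1 - p.2) | p in Y `*` Y]).
have [[r [p Yp pr]] ub] := ys.
apply: (@le_trans _ _ r); first by rewrite -pr enorm_ge0.
by apply: ub_le_sup => //; exists p.
Qed.

(** A closed set is Borel, so each sample, having law [P], lies in [Y] outside a null set; countably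
    many null sets are discarded. *)
Lemma ae_sample_mem {R : realType} {m} {d} {T : measurableType d}
    (Pr : probability T R) (P : probability (borel_rV R m) R)
    (y : nat -> {RV Pr >-> borel_rV R m}) (Y : set 'rV[R]_m) :
  closed Y -> P Y = 1%E -> iid_samples P y ->
  \forall w \ae Pr, forall j, Y (y j w).
Proof.
move=> Ycl PY [_ yP]; apply: ae_foralln => j.
have mY : measurable (Y : set (borel_rV R m)).
  rewrite -(setCK Y); apply: measurableC; apply: sub_sigma_algebra.
  exact: closed_openC.
have myY : measurable (y j @^-1` Y).
  by rewrite -[X in measurable X]setTI; exact: measurable_funP.
exists (~` (y j @^-1` Y)); split => //; first exact: measurableC.
have PyY : Pr (y j @^-1` Y) = 1%E by rewrite -PY -(yP j _ mY).
apply: etrans (probability_setC Pr myY) _.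
by move: PyY => ->; rewrite subee.
Qed.

(** * Upper bounds for the Clarke derivative of [VN] *)

Section ClarkeOfModel.
Context {R : realType} {n m : nat}.
Variables (f : 'rV[R]_n * 'rV[R]_m -> R) (Y : set 'rV[R]_m) (L Lhat : R).
Variables (U : set ('rV[R]_n * 'rV[R]_m)) (x : 'rV[R]_n).
Hypotheses (U_open : open U) (f_C2 : C2_on U f) (YU : forall y, Y y -> U (x, y)).
Hypotheses (Y_neq0 : Y !=set0) (Y_compact : compact Y) (Y_seg : segment_closed Y).
Hypotheses (L_gt0 : 0 < L) (Lhat_gt : L < Lhat).
Hypothesis (grad_lip : forall y y', Y y -> Y y' ->
  enorm (grad f (x, y) - grad f (x, y')) <= L * enorm (y - y')).

Let f_diff y : Y y -> differentiable f (x, y).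
Proof. by move=> /YU /f_C2[]. Qed.

Let Lhat_gt0 : 0 < Lhat := lt_trans L_gt0 Lhat_gt.
Let Y_closed : closed Y := compact_closed (@norm_hausdorff _ _) Y_compact.

(* The mixed derivative is estimated along a segment of Y only, since X may have
   an empty interior. *)
Lemma mixed_derive_le y z d : Y y -> Y z ->
  'D_(0, z - y) ('D_(d, 0) f) (x, y) <= L * enorm (z - y) * enorm d.
Proof.
move=> Yy Yz.
have t0 : (t : R) @[t --> (0 : R)^'+] --> (0 : R) by exact: cvg_within.
have quot : ('D_(d, 0) f ((x, y) + t *: (0, z - y)) - 'D_(d, 0) f (x, y)) / t
    @[t --> (0 : R)^'+] --> 'D_(0, z - y) ('D_(d, 0) f) (x, y).
  apply: (C2_cvg_quotient2 U_open f_C2 (cvg_cst (x, y)) t0 _ (YU Yy)).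
  exact: nbhs_right_gt.
apply: cvgr_to_le quot _; near=> t.
have tgt0 : 0 < t by near: t; exact: nbhs_right_gt.
have tlt1 : t < 1 by near: t; exact: nbhs_right_lt.
have Yt : Y (y + t *: (z - y)) by apply: Y_seg => //; rewrite !ltW.
rewrite addr_scale_inr ler_pdivrMr// !derive_gradx; [|exact: f_diff..].
rewrite -dotNl -dotDl (le_trans (dot_le_enorm _ _))//.
rewrite mulrAC ler_wpM2r ?enorm_ge0//.
rewrite (le_trans (gradx_lip grad_lip Yt Yy))// [y + _]addrC addrK enormZ.
by rewrite gtr0_norm// -mulrA (mulrC t).
Unshelve. all: by end_near. Qed.

(** An index attaining the maximum at the displaced point is eventually active at [x], and the
    quotient of [VN] is at most that of [q] at this index. Hence only active indices need the bound
    [M]. *)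
Lemma VN_quotient_le (T : Type) (F : set_system T) {FF : Filter F}
    (h : T -> 'rV[R]_n) (tau : T -> R) N (s : 'I_N -> 'rV[R]_m) d (M e : R) :
  h t @[t --> F] --> x -> tau t @[t --> F] --> 0 -> (\forall t \near F, 0 < tau t) ->
  (0 < N)%N -> (forall j, Y (s j)) ->
  (forall j, q f Y Lhat x (s j) = VN f Y Lhat s x ->
    'D_(d, 0) f (x, s j) +
    'D_(0, model_argmax f Y Lhat x (s j) - s j) ('D_(d, 0) f) (x, s j) <= M) ->
  0 < e ->
  \forall t \near F,
    (VN f Y Lhat s (h t + tau t *: d) - VN f Y Lhat s (h t)) / tau t <= M + e.
Proof.
move=> hx tau0 taugt0 N0 Ys activeM e0.
have hx' : h t + tau t *: d @[t --> F] --> x.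
  rewrite -[x in _ --> x]addr0 -(scale0r d); apply: cvgD => //.
  exact: cvgZr_tmp.
pose Q p j := q f Y Lhat p (s j).
have VNP p : exists j, VN f Y Lhat s p = Q p j /\ forall i, Q p i <= Q p j.
  exact: sup_ord_attained.
have [j0 [j0VN j0max]] := VNP x.
(* Since there are finitely many indices, one set of the filter serves all: active ones satisfy the
   quotient bound, the others stay strictly below the active [j0]. *)
have H : \forall t \near F, forall j,
    (Q x j = Q x j0 -> (Q (h t + tau t *: d) j - Q (h t) j) / tau t <= M + e) /\
    (Q x j < Q x j0 -> Q (h t + tau t *: d) j < Q (h t + tau t *: d) j0).
  apply: filter_forall => j.
  have [jj0|jj0] := eqVneq (Q x j) (Q x j0).
    have qle := q_quotient_le U_open f_C2 Y_neq0 Y_closed Y_seg Lhat_gt0 d (YU (Ys j))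
      hx tau0 taugt0 e0.
    apply: filterS (qle FF) => t te; split; last by rewrite jj0 ltxx.
    move=> _; apply: le_trans te _; rewrite lerD2r.
    by apply: activeM; rewrite j0VN.
  have Qlt : Q x j < Q x j0 by rewrite lt_neqAle jj0 j0max.
  have cj := cvg_q f_C2 Y_neq0 Y_closed Y_seg Lhat_gt0 (YU (Ys j)) hx'.
  have cj0 := cvg_q f_C2 Y_neq0 Y_closed Y_seg Lhat_gt0 (YU (Ys j0)) hx'.
  have cB : Q (h t + tau t *: d) j - Q (h t + tau t *: d) j0 @[t --> F] -->
    Q x j - Q x j0 by exact: (cvgB (cj FF) (cj0 FF)).
  have B0 : Q x j - Q x j0 < 0 by rewrite subr_lt0.
  apply: (filterS _ (cvgr_lt _ cB _ B0)) => t; rewrite subr_lt0 => tj; split => // jE.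
  by rewrite jE eqxx in jj0.
apply: (filterS _ (filterI H taugt0)) => t [Ht t0].
have [j [-> jmax]] := VNP (h t + tau t *: d).
have [act nact] := Ht j.
have [i [Vi imax]] := VNP (h t).
have jact : Q x j = Q x j0.
  have := j0max j; rewrite le_eqVlt => /orP[/eqP//|/nact].
  by rewrite ltNge jmax.
apply: le_trans (act jact); rewrite ler_wpM2r ?invr_ge0 ?(ltW t0)//.
by rewrite lerD2l lerN2 Vi.
Qed.

Lemma clarke_VN_dot_le N (s : 'I_N -> 'rV[R]_m) z d (M : R) :
  (0 < N)%N -> (forall j, Y (s j)) ->
  clarke (VN f Y Lhat s) x z ->
  (forall j, q f Y Lhat x (s j) = VN f Y Lhat s x ->
    'D_(d, 0) f (x, s j) +
    'D_(0, model_argmax f Y Lhat x (s j) - s j) ('D_(d, 0) f) (x, s j) <= M) ->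
  dot z d <= M.
Proof.
move=> N0 Ys zVN activeM; apply: (clarke_dot_le (d := d) zVN) => e e0.
apply: VN_quotient_le => //; first exact: cvg_fst.
- by apply: (@cvg_trans _ (0 : R)^'+); [exact: cvg_snd|exact: cvg_within].
- exact: (cvg_snd (nbhs_right_gt 0)).
Qed.

End ClarkeOfModel.

(** * Assembly of the subdifferential estimate *)

Unset Implicit Arguments.
Set Strict Implicit.

Theorem theorem2 (R : realType) (n m : nat)
  (X : set 'rV[R]_n) (Y : set 'rV[R]_m)
  (X_neq0 : X !=set0) (X_compact : compact X)
  (X_convex : convex_set (X : set (convex_lmodType 'rV[R]_n)))
  (Y_neq0 : Y !=set0) (Y_compact : compact Y)
  (Y_convex : convex_set (Y : set (convex_lmodType 'rV[R]_m)))
  (f : 'rV[R]_n * 'rV[R]_m -> R) (U : set ('rV[R]_n * 'rV[R]_m))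
  (U_open : open U) (XY_sub_U : X `*` Y `<=` U) (f_C2 : C2_on U f)
  (L L0 Lhat : R) (L_gt0 : 0 < L) (L0_gt0 : 0 < L0) (Lhat_gt : L < Lhat)
  (grad_lip : forall p p', (X `*` Y) p -> (X `*` Y) p' ->
     enorm (grad f p - grad f p') <= L * pnorm (p - p'))
  (hess_lip : forall p p', (X `*` Y) p -> (X `*` Y) p' ->
     opnorm (hessxy f p - hessxy f p') <= L0 * pnorm (p - p'))
  (grad_bound : forall p, (X `*` Y) p -> enorm (grad f p) <= L)
  (d : measure_display) (T : measurableType d) (Pr : probability T R)
  (P : probability (borel_rV R m) R) (P_supp : P Y = 1%E)
  (y : nat -> {RV Pr >-> borel_rV R m}) (y_iid : iid_samples P y)
  (C0 gamma delta0 : R)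
  (C0_gt0 : 0 < C0) (gamma_gt0 : 0 < gamma) (delta0_gt0 : 0 < delta0)
  (P_mass : lower_mass P Y C0 gamma delta0)
  (kappap : 'rV[R]_n -> R) (f_PL : PL f Y X kappap) :
  (\forall w \ae Pr, forall j, Y (y j w)) /\
  forall (w : T) (N : nat), (0 < N)%N -> (forall j : 'I_N, Y (y j w)) ->
    forall x, X x ->
      (excess (clarke (VN f Y Lhat (fun j : 'I_N => y j w)) x)
              (clarke (V f Y) x)
       <= (Lkappa Y Lhat L L0 kappap x
           * beta Y (fun j : 'I_N => y j w))%:E)%E.
Proof.
have Y_closed : closed Y := compact_closed (@norm_hausdorff _ _) Y_compact.
split; first exact: (ae_sample_mem Y_closed P_supp y_iid).
move=> w N N0 Ys x Xx; set s := fun j : 'I_N => y j w.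
have Y_seg := convex_set_segment_closed Y_convex.
have Lhat_gt0 := lt_trans L_gt0 Lhat_gt.
have YU z : Y z -> U (x, z) by move=> Yz; apply: XY_sub_U.
have f_diff z : Y z -> differentiable f (x, z) by move=> /YU /f_C2[].
have lip z z' : Y z -> Y z' ->
    enorm (grad f (x, z) - grad f (x, z')) <= L * enorm (z - z').
  move=> Yz Yz'.
  have E : (x, z) - (x, z') = (0, z - z') by congr (_, _); rewrite /= subrr.
  have := grad_lip (x, z) (x, z') (conj Xx Yz) (conj Xx Yz').
  by rewrite E pnorm_inr.
have [kp0 PLx] := f_PL x Xx.
have beta0 : 0 <= beta Y s by exact: beta_ge0.
have VNP : exists j, VN f Y Lhat s x = q f Y Lhat x (s j) /\
    forall i, q f Y Lhat x (s i) <= q f Y Lhat x (s j) by exact: sup_ord_attained.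
have [y0 Yy0 y0V] := V_attained Y_neq0 Y_compact f_diff.
have V_sub_VN : V f Y x - VN f Y Lhat s x <= Lhat * beta Y s ^+ 2.
  have [i ibeta] := beta_cover s N0 Y_compact Yy0.
  have [j [-> jmax]] := VNP.
  have := le_q Y_neq0 Y_compact Y_seg f_diff L_gt0 lip Lhat_gt (Ys i) Yy0.
  have : Lhat * enorm (y0 - s i) ^+ 2 <= Lhat * beta Y s ^+ 2.
    by rewrite ler_pM2l// ler_pXn2r ?nnegrE ?enorm_ge0.
  by have := jmax i; rewrite y0V /s; lra.
set sq := Num.sqrt (Lhat / kappaq Lhat L kappap x).
have sq0 : 0 <= sq by exact: sqrtr_ge0.
have C1 : 0 <= (3 + L / Lhat) * L by rewrite mulr_ge0 ?addr_ge0 ?divr_ge0 ?ltW.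
have LkE : (3 + L / Lhat) * L * (sq * beta Y s) <= Lkappa Y Lhat L L0 kappap x * beta Y s.
  rewrite mulrA ler_wpM2r// /Lkappa -/sq ler_wpM2r// lerDr.
  by rewrite mulr_ge0 ?diam_ge0// ltW.
apply: excess_clarke_le.
- by exists (gradx f (x, y0)); apply: (gradx_clarke_V U_open f_C2).
- move=> z b zVN [_ bproj].
  apply: (clarke_VN_dot_le U_open f_C2 YU Y_neq0 Y_compact Y_seg L_gt0 Lhat_gt N0 Ys zVN).
  move=> j jVN; have Yj := Ys j.
  have [|ybar [Yb bV yb]] := q_error_bound Y_neq0 Y_compact Y_seg f_diff L_gt0 lip
    Lhat_gt kp0 PLx Yj beta0.
    by rewrite jVN.
  (* The projection inequality tested at this subgradient gives [dot (gradx f (x, ybar)) (z - b) <=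
     dot b (z - b)]. *)
  have := bproj _ (gradx_clarke_V U_open f_C2 YU Y_neq0 Y_compact Yb bV).
  have mixed := mixed_derive_le U_open f_C2 YU Y_seg lip (z - b) Yj
    (model_argmaxY f Lhat Y_neq0 Y_closed Y_seg x (s j)).
  have zd := zhat_dist Y_neq0 Y_compact Y_seg f_diff L_gt0 lip Lhat_gt Yj Yb bV.
  have gd : dot (gradx f (x, s j) - gradx f (x, ybar)) (z - b) <=
      L * enorm (s j - ybar) * enorm (z - b).
    rewrite (le_trans (dot_le_enorm _ _))// ler_wpM2r ?enorm_ge0//.
    exact: (gradx_lip lip).
  rewrite derive_gradx; last exact: f_diff.
  move: mixed gd; move: (z - b) => v mixed gd; rewrite dotC.
  rewrite !dotE in gd *; have v0 := enorm_ge0 v.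
  have wv : L * enorm (model_argmax f Y Lhat x (s j) - s j) * enorm v <=
      L * ((2 + L / Lhat) * enorm (s j - ybar)) * enorm v.
    by rewrite ler_wpM2r// ler_wpM2l// ltW.
  (* The factor [3 + L / Lhat] is the sum of [2 + L / Lhat] from the mixed derivative and 1 from
     replacing [s j] by [ybar] in [gradx]. *)
  have rv : (3 + L / Lhat) * L * enorm (s j - ybar) * enorm v <=
      Lkappa Y Lhat L L0 kappap x * beta Y s * enorm v.
    by rewrite ler_wpM2r// (le_trans _ LkE)// ler_wpM2l.
  by move: mixed gd wv rv; lra.
- by apply: le_trans LkE; rewrite mulr_ge0// mulr_ge0.
Qed.
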